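(* Let $L/K$ be a finite unramified extension of $p$-adic fields with Galois group $G$, and let $H = L[N]^G$ be a Hopf algebra giving a Hopf-Galois structure on $L/K$, where $N$ is a regular subgroup of $\mathrm{Perm}(G)$ normalised by $\lambda(G)$. Let $\mathfrak{A}_H = \{h \in H \mid h\cdot x \in \mathfrak{O}_L \text{ for all } x \in \mathfrak{O}_L\}$. Then $\mathfrak{A}_H = \mathfrak{O}_L[N]^G$ and $\mathfrak{O}_L$ is a free $\mathfrak{A}_H$-module.
   Context: A $p$-adic field is a finite extension of $\mathbb{Q}_p$; $\mathfrak{O}_L$ denotes the valuation ring of $L$. An unramified extension $L/K$ of $p$-adic fields is automatically Galois. Hopf-Galois structures: a finite-dimensional $K$-Hopf algebra $H$ (counit $\varepsilon$, comultiplication $\Delta(h)=\sum_{(h)} h_{(1)}\otimes h_{(2)}$) gives a Hopf-Galois structure on $L/K$ if $L$ is an $H$-module with $h\cdot(st)=\sum_{(h)}(h_{(1)}\cdot s)(h_{(2)}\cdot t)$, $h\cdot 1=\varepsilon(h)1$, and the map $L\otimes_K H\to \mathrm{End}_K(L)$, $s\otimes h\mapsto (t\mapsto s(h\cdot t))$, is bijective. Greither–Pareigis description for a finite Galois extension $L/K$ with group $G$: let $\lambda:G\to\mathrm{Perm}(G)$ be left translation, $\lambda(g)(x)=gx$. A subgroup $N\le\mathrm{Perm}(G)$ is regular if $|N|=|G|$ and $N$ is transitive on $G$. The Hopf-Galois structures on $L/K$ correspond bijectively to regular subgroups $N$ normalised by $\lambda(G)$. The Hopf algebra corresponding to $N$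 is $H=L[N]^G$, the fixed points of $G$ acting on $L[N]$ simultaneously on the coefficients by Galois automorphisms and on $N$ by $n\mapsto\lambda(g)n\lambda(g)^{-1}$, with Hopf structure maps inherited from the group algebra $L[N]$; it acts on $L$ by $\left(\sum_{n} c_n n\right)\cdot x=\sum_n c_n\,(n^{-1}(1_G))(x)$. $\mathfrak{O}_L[N]^G=\mathfrak{O}_L[N]\cap L[N]^G$. *)

(* Defs.v *)
From HB Require Import structures.
From mathcomp Require Import all_boot all_order all_algebra.
From mathcomp Require Import all_fingroup all_field.
From mathcomp Require Import boolp classical_sets.

Set Implicit Arguments.
Unset Strict Implicit.
Unset Printing Implicit Defensive.

Import Order.TTheory GRing.Theory Num.Theory.
Local Open Scope ring_scope.

(* Z_p as the inverse limit of the rings Z/p^n, each residue class being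
   represented by its representative in [0, p^n[. *)
Record padic_int (p : nat) (hp : prime p) := PadicInt {
  padic_digit :> nat -> int;
  padic_compat : forall n,
    padic_digit n = (padic_digit n.+1 %% (p ^ n)%N%:Z)%Z }.

Section PadicInt.
Variables (p : nat) (hp : prime p).
Local Notation Zp := (padic_int hp).
Local Notation q n := ((p ^ n)%N%:Z).

HB.instance Definition _ := gen_eqMixin Zp.
HB.instance Definition _ := gen_choiceMixin Zp.

Lemma padic_eq (x y : Zp) : (forall n, x n = y n) -> x = y.
Proof.
case: x y => [f cf] [g cg] /= /funext eq_fg.
by case: g / eq_fg cg => cg; congr PadicInt; apply: Prop_irrelevance.
Qed.

Lemma padic_modz (x : Zp) n : (x n %% q n)%Z = x n.
Proof. by rewrite (padic_compat x n) modz_mod. Qed.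

Lemma modz_pow (m : int) n k : (k <= n)%N -> ((m %% q n)%Z %% q k)%Z = (m %% q k)%Z.
Proof.
move=> le_kn; have qnE : q n = q (n - k)%N * q k.
  by rewrite -PoszM -expnD subnK.
have -> : (m %% q n)%Z = - (m %/ q n)%Z * q (n - k)%N * q k + m.
  by rewrite {3}(divz_eq m (q n)) -mulrA -qnE mulNr addKr.
by rewrite modzMDl.
Qed.

Lemma padic_trunc_compat (f : nat -> int) :
  (forall n, (f n.+1 = f n %[mod q n])%Z) ->
  forall n, (f n %% q n)%Z = ((f n.+1 %% q n.+1)%Z %% q n)%Z.
Proof. by move=> cf n; rewrite modz_pow // cf. Qed.

Definition padic_trunc f cf : Zp :=
  PadicInt hp (@padic_trunc_compat f cf).

Lemma padic_compat_mod (x : Zp) n : (x n.+1 = x n %[mod q n])%Z.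
Proof. by rewrite (padic_compat x n) modz_mod. Qed.

Lemma padic_const_subproof (a : int) n : (a = a %[mod q n])%Z.
Proof. by []. Qed.
Definition padic_const a : Zp := padic_trunc (padic_const_subproof a).

Lemma padic_opp_subproof (x : Zp) n : (- x n.+1 = - x n %[mod q n])%Z.
Proof. by rewrite -modzNm padic_compat_mod modzNm. Qed.
Definition padic_opp x : Zp := padic_trunc (padic_opp_subproof x).

Lemma padic_add_subproof (x y : Zp) n :
  (x n.+1 + y n.+1 = x n + y n %[mod q n])%Z.
Proof. by rewrite -modzDm !padic_compat_mod modzDm. Qed.
Definition padic_add x y : Zp := padic_trunc (padic_add_subproof x y).

Lemma padic_mul_subproof (x y : Zp) n :
  (x n.+1 * y n.+1 = x n * y n %[mod q n])%Z.
Proof. by rewrite -modzMm !padic_compat_mod modzMm. Qed.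
Definition padic_mul x y : Zp := padic_trunc (padic_mul_subproof x y).

Fact padic_addA : associative padic_add.
Proof.
by move=> x y z; apply: padic_eq => n /=; rewrite modzDml modzDmr addrA.
Qed.
Fact padic_addC : commutative padic_add.
Proof. by move=> x y; apply: padic_eq => n /=; rewrite addrC. Qed.
Fact padic_add0 : left_id (padic_const 0) padic_add.
Proof.
by move=> x; apply: padic_eq => n /=; rewrite modzDml add0r padic_modz.
Qed.
Fact padic_addN : left_inverse (padic_const 0) padic_opp padic_add.
Proof. by move=> x; apply: padic_eq => n /=; rewrite modzDml addNr. Qed.

HB.instance Definition _ := GRing.isZmodule.Build Zp
  padic_addA padic_addC padic_add0 padic_addN.

Fact padic_mulA : associative padic_mul.
Proof.
by move=> x y z; apply: padic_eq => n /=; rewrite modzMml modzMmr mulrA.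
Qed.
Fact padic_mulC : commutative padic_mul.
Proof. by move=> x y; apply: padic_eq => n /=; rewrite mulrC. Qed.
Fact padic_mul1 : left_id (padic_const 1) padic_mul.
Proof.
by move=> x; apply: padic_eq => n /=; rewrite modzMml mul1r padic_modz.
Qed.
Fact padic_mulDl : left_distributive padic_mul padic_add.
Proof.
by move=> x y z; apply: padic_eq => n /=; rewrite modzMml modzDm mulrDl.
Qed.
Fact padic_1neq0 : padic_const 1 != 0.
Proof.
apply/eqP => /(congr1 (fun x : Zp => x 1%N)) /=.
have p1 := prime_gt1 hp.
by rewrite mod0z modz_small // expn1 ltz_nat p1.
Qed.

HB.instance Definition _ := GRing.Zmodule_isComNzRing.Build Zp
  padic_mulA padic_mulC padic_mul1 padic_mulDl padic_1neq0.

Definition padic_unit (x : Zp) : bool := `[< exists y, y * x = 1 >].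
Definition padic_inv (x : Zp) : Zp :=
  if pselect (exists y, y * x = 1) is left ex then projT1 (cid ex) else x.

Fact padic_mulVx : {in padic_unit, left_inverse 1 padic_inv *%R}.
Proof.
move=> x /asboolP ux; rewrite /padic_inv.
by case: pselect => // ex; case: (cid ex).
Qed.
Fact padic_unitP (x y : Zp) : y * x = 1 -> padic_unit x.
Proof. by move=> yx; apply/asboolP; exists y. Qed.
Fact padic_inv_out : {in [predC padic_unit], padic_inv =1 id}.
Proof.
move=> x nux; rewrite /padic_inv; case: pselect => // ux.
by case/negP: nux; apply/asboolP.
Qed.

HB.instance Definition _ := GRing.ComNzRing_hasMulInverse.Build Zp
  padic_mulVx padic_unitP padic_inv_out.

Lemma padic_modz_le (x : Zp) n k : (k <= n)%N -> x k = (x n %% q k)%Z.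
Proof.
elim: n => [|n IHn]; first by rewrite leqn0 => /eqP->; rewrite padic_modz.
rewrite leq_eqVlt ltnS => /predU1P[-> | le_kn]; first by rewrite padic_modz.
by rewrite IHn // padic_compat modz_pow.
Qed.

Lemma padic_mul_eq0 (x y : Zp) : x * y = 0 -> (x == 0) || (y == 0).
Proof.
have nz (z : Zp) : z != 0 -> exists n, z n != 0.
  move=> z0; apply: contrapT => nex; case/eqP: z0; apply: padic_eq => n.
  by rewrite /= mod0z; apply: contrapT => /eqP zn; apply: nex; exists n.
move=> xy0; apply: contraT; rewrite negb_or => /andP[/nz[i xi] /nz[j yj]].
have /= := congr1 (fun z : Zp => z (i + j)%N) xy0.
rewrite mod0z => /dvdz_mod0P; rewrite dvdzE abszM /=.
have logE (c : int) k : (c %% q k)%Z != 0 -> (0 < `|c|)%N /\ (logn p `|c| < k)%N.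
  move=> /eqP ck; have c0 : (0 < `|c|)%N.
    by rewrite absz_gt0; apply: contra_notN ck => /eqP->; rewrite mod0z.
  split=> //; rewrite ltnNge -pfactor_dvdn //; apply: contra_notN ck => pc.
  by apply/dvdz_mod0P; rewrite dvdzE.
move: xi yj; rewrite (padic_modz_le x (leq_addr j i)).
rewrite (padic_modz_le y (leq_addl i j)) => /logE[x0 xi] /logE[y0 yj].
rewrite pfactor_dvdn ?muln_gt0 ?x0 // lognM // leqNgt.
by rewrite -addnS leq_add // ltnW.
Qed.

HB.instance Definition _ := GRing.ComUnitRing_isIntegral.Build Zp padic_mul_eq0.

End PadicInt.

Definition padic_rat (p : nat) (hp : prime p) : fieldType :=
  {fraction padic_int hp}.

(* L is a finite extension of K, itself a finite extension of Q_p; K and Q_p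
   are identified with their images in L. A valuation on L is given by its
   values on L \ {0}; its value at 0 is meant to be +oo and is never used.
   Extending the p-adic valuation of Z_p amounts to extending that of
   Q_p = Frac Z_p, by multiplicativity; x in Z_p has valuation n when p^n
   divides x and p^(n+1) does not. *)
Section Valuation.
Variables (p : nat) (hp : prime p) (K : fieldExtType (padic_rat hp)).
Variables (L : fieldExtType K) (v : L -> rat).

Definition is_valuation : Prop :=
  (forall x y, x != 0 -> y != 0 -> v (x * y) = v x + v y) /\
  (forall x y, x != 0 -> y != 0 -> x + y != 0 ->
     Num.min (v x) (v y) <= v (x + y)).

Definition extends_padic_valuation : Prop :=
  is_valuation /\
  forall (x : padic_int hp) (n : nat), x n = 0 -> x n.+1 != 0 ->
    v (((FracField.tofrac x : padic_rat hp)%:A : K)%:A) = n%:R.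

Definition valuation_ring : set L := [set x | x != 0 -> 0 <= v x].

(* Ramification index one: v takes the same values on K \ {0} and L \ {0}.
   Separability of the residue extension is automatic, the residue fields being
   finite. *)
Definition unramified : Prop :=
  forall x : L, x != 0 -> exists2 y : K, y != 0 & v y%:A = v x.
End Valuation.

(* The group algebra F[Perm T], where the product of Perm T is composition of
   functions. In perm.v, s * t denotes t \o s, whence the order of the factors
   in the convolution: n \o m = k iff n = m^-1 * k. *)
Definition perm_algebra (F : fieldType) (T : finType) := {ffun {perm T} -> F}.

Section PermAlgebra.
Variables (F : fieldType) (T : finType).
Local Notation FP := (perm_algebra F T).

HB.instance Definition _ := GRing.Zmodule.copy FP {ffun {perm T} -> F}.

Definition perm_algebra_one : FP := [ffun n => (n == 1%g)%:R].
Definition perm_algebra_mul (a b : FP) : FP :=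
  [ffun k => \sum_(m : {perm T}) a (m^-1 * k)%g * b m].

Fact perm_algebra_mulA : associative perm_algebra_mul.
Proof.
move=> a b c; apply/ffunP => k; rewrite !ffunE.
under eq_bigr do rewrite ffunE mulr_sumr.
under [RHS]eq_bigr do rewrite ffunE mulr_suml.
rewrite exchange_big /=; apply: eq_bigr => l _.
rewrite (reindex_inj (mulgI l)) /=; apply: eq_bigr => m _.
by rewrite invMg mulKg mulgA mulrA.
Qed.
Fact perm_algebra_mul1l : left_id perm_algebra_one perm_algebra_mul.
Proof.
move=> a; apply/ffunP => k; rewrite ffunE (bigD1 k) //= big1 ?addr0.
  by rewrite ffunE mulVg eqxx mul1r.
by move=> m /negPf mk; rewrite ffunE -eq_mulVg1 mk mul0r.
Qed.
Fact perm_algebra_mul1r : right_id perm_algebra_one perm_algebra_mul.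
Proof.
move=> a; apply/ffunP => k; rewrite ffunE (bigD1 1%g) //= big1 ?addr0.
  by rewrite ffunE eqxx mulr1 invg1 mul1g.
by move=> m /negPf m1; rewrite ffunE m1 mulr0.
Qed.
Fact perm_algebra_mulDl : left_distributive perm_algebra_mul +%R.
Proof.
move=> a b c; apply/ffunP => k; rewrite !ffunE -big_split.
by apply: eq_bigr => m _; rewrite ffunE mulrDl.
Qed.
Fact perm_algebra_mulDr : right_distributive perm_algebra_mul +%R.
Proof.
move=> a b c; apply/ffunP => k; rewrite !ffunE -big_split.
by apply: eq_bigr => m _; rewrite ffunE mulrDr.
Qed.
Fact perm_algebra_1neq0 : perm_algebra_one != 0.
Proof.
by apply/eqP => /ffunP/(_ 1%g)/eqP; rewrite !ffunE eqxx oner_eq0.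
Qed.

HB.instance Definition _ := GRing.Zmodule_isNzRing.Build FP
  perm_algebra_mulA perm_algebra_mul1l perm_algebra_mul1r
  perm_algebra_mulDl perm_algebra_mulDr perm_algebra_1neq0.
End PermAlgebra.

(* X is a free A-module: A is a subring of R, X is an additive subgroup of M on
   which act defines a module structure over A, and B is a basis of it. *)
Section FreeModule.
Variables (R : nzRingType) (M : zmodType) (act : R -> M -> M).
Variables (A : set R) (X : set M).
Local Open Scope classical_set_scope.

Definition is_subring : Prop :=
  [/\ A 1, (forall a b, A a -> A b -> A (a - b))
    & (forall a b, A a -> A b -> A (a * b))].

Definition is_module : Prop :=
  [/\ X 0, (forall x y, X x -> X y -> X (x - y)),
      (forall a x, A a -> X x -> X (act a x)),
      (forall x, X x -> act 1 x = x)
    & (forall a b x, A a -> A b -> X x -> act (a * b) x = act a (act b x))] /\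
  (forall a x y, A a -> X x -> X y -> act a (x + y) = act a x + act a y) /\
  (forall a b x, A a -> A b -> X x -> act (a + b) x = act a x + act b x).

Definition is_basis (B : set M) : Prop :=
  [/\ B `<=` X,
      (forall x, X x -> exists (s : seq M) (c : M -> R),
         [/\ {in s, forall b, B b}, {in s, forall b, A (c b)}
           & x = \sum_(b <- s) act (c b) b])
    & (forall (s : seq M) (c : M -> R), uniq s -> {in s, forall b, B b} ->
         {in s, forall b, A (c b)} ->
         \sum_(b <- s) act (c b) b = 0 -> {in s, forall b, c b = 0})].

Definition is_free_module : Prop :=
  [/\ is_subring, is_module & exists B, is_basis B].
End FreeModule.

Section HopfGalois.
Variables (K : fieldType) (L : splittingFieldType K).
(* The Galois group of L / K. In galois.v, g * h denotes h \o g: the product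
   gh of the usual convention is (h * g)%g. *)
Local Notation G := (gal_of {:L}).
Local Notation LP := (perm_algebra L G).
Local Open Scope classical_set_scope.

Lemma galois_groupE : 'Gal({:L} / 1)%g = [set: G]%SET.
Proof.
by apply/setP=> g; rewrite inE gal_kAut ?sub1v // kAut1E limg_gal subvv.
Qed.

(* lambda g is x |-> g \o x. *)
Definition lambda (g : G) : {perm G} := perm (mulIg g).

Definition regular (N : {set {perm G}}) : Prop :=
  #|N| = #|[set: G]%SET| /\ [transitive N, on [set: G]%SET | 'P].

Definition normalised_by_lambda (N : {set {perm G}}) : Prop :=
  forall g, (lambda g) \in 'N(N)%g.

(* The simultaneous action of g on coefficients and, through
   n |-> lambda g \o n \o (lambda g)^-1, on permutations; this last map is
   n |-> (n ^ lambda g)%g, whose inverse appears in the coefficients. *)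
Definition galois_act (g : G) (c : LP) : LP :=
  [ffun n => g (c (n ^ (lambda g)^-1)%g)].

Variable N : {group {perm G}}.

(* L[N]^G, where L[N] is the subalgebra of elements of L[Perm G] that are
   supported in N. *)
Definition hopf_algebra : set LP :=
  [set c : LP | (forall n, n \notin N -> c n = 0) /\
                (forall g, galois_act g c = c)].

Definition hopf_act (c : LP) (x : L) : L :=
  \sum_(n in N) c n * (n^-1%g 1%g : G) x.

Definition associated_order (O : set L) : set LP :=
  [set h | hopf_algebra h /\ forall x, O x -> O (hopf_act h x)].

Definition integral_fixed_points (O : set L) : set LP :=
  [set h | hopf_algebra h /\ forall n, O (h n)].
End HopfGalois.

(* Main.v *)
Require Import Defs.
From HB Require Import structures.
From mathcomp Require Import boolp classical_sets.
From mathcomp Require Import all_boot all_order all_algebra.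
From mathcomp Require Import all_fingroup all_solvable all_field.
From mathcomp Require Import zify lra.

(* The valuation v is the only one extending that of Q_p: by compactness of
   Z_p^d any two such valuations on L differ by a bounded amount, hence agree
   after taking powers. So G preserves O_L, the residue field l is finite, and G
   acts faithfully on l: if h of prime order acted trivially, every residue class
   would contain an h-fixed element (a trace, or the norm of a root when the
   order is the residue characteristic), and, uniformizers being available in K,
   h x - x would be divisible by all powers of the maximal ideal.

   If h in H maps O_L to itself, dividing h by a coefficient of least negative
   valuation and reducing would give a nontrivial linear relation between
   distinct automorphisms of l; so the associated order is O_L[N]^G.

   For freeness, consider the l[N]-module Map(G, l), on which N acts by
   permutations of G. It has two semilinear G-actions, whose fixed points are l
   and l[N]^G. By Galois descent and inclusion-exclusion over annihilators, l
   contains as many elements with trivial annihilator in l[N]^G as l[N]^G itself,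
   hence at least one. A lift m of it to O_L generates O_L freely: the system
   expressing y in O_L as h m is square and injective modulo the maximal ideal. *)

Set Implicit Arguments.
Unset Strict Implicit.
Unset Printing Implicit Defensive.

Import Order.TTheory GRing.Theory Num.Theory.
Local Open Scope ring_scope.

(** * Galois descent over a finite field *)

(** Values are twisted by [sigma g], arguments moved by [tau g]. With [X] the group this acts on
    Map(G, E), with [X] its permutations on the group algebra. *)
Definition semilinear_act (E : fieldType) (gT : finGroupType)
    (sigma : gT -> {rmorphism E -> E}) (X : finType) (tau : gT -> {perm X}) g
    (f : {ffun X -> E}) : {ffun X -> E} :=
  [ffun x => sigma g (f ((tau g)^-1 x)%g)].

Section DualBasis.
Variables (E : finFieldType) (gT : finGroupType).
Variable sigma : gT -> {rmorphism E -> E}.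
Hypothesis sigma1 : forall x, sigma 1%g x = x.
Hypothesis sigmaM : forall g h x, sigma (g * h)%g x = sigma h (sigma g x).
Hypothesis sigma_faithful : forall g, sigma g =1 id -> g = 1%g.
Local Notation n := #|gT|.

Lemma finField_generator (F : finFieldType) :
  exists theta : F, forall x, x != 0 -> exists k, x = theta ^+ k.
Proof.
have /cyclicP[u uG] := field_unit_group_cyclic [set: {unit F}]%G.
exists (val u) => x x0.
have xU : x \is a GRing.unit by rewrite unitfE.
have : Sub x xU \in <[u]>%g by rewrite -uG inE.
by case/cycleP=> k /(congr1 val); rewrite SubK FinRing.val_unitX => ->; exists k.
Qed.

(** The powers of the conjugates of a generator [theta] form a Vandermonde matrix, invertible
    because faithfulness makes the conjugates distinct. The [y i] are the row of its inverse at the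
    identity; the two identities express that [V] and [W] are inverse on both sides. *)
Lemma dual_basis : exists x y : 'I_n -> E,
  (forall g, \sum_i x i * sigma g (y i) = (g == 1%g)%:R) /\
  (forall i j, \sum_g sigma g (x i * y j) = (i == j)%:R).
Proof.
have [theta thetaP] := finField_generator E.
have theta_inj g h : sigma g theta = sigma h theta -> g = h.
  move=> gh; apply/eqP; rewrite eq_mulgV1; apply/eqP/sigma_faithful => x.
  have [->|/thetaP[k ->]] := eqVneq x 0; first by rewrite rmorph0.
  by rewrite rmorphXn sigmaM gh -sigmaM mulgV sigma1.
pose a := \row_(j < n) sigma (enum_val j) theta.
pose V := Vandermonde n a.
have Vu : V \in unitmx.
  rewrite unitmxE unitfE det_Vandermonde; apply/prodf_neq0 => i _.
  apply/prodf_neq0 => j ij; rewrite subr_eq0 !mxE.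
  apply/eqP => /theta_inj/enum_val_inj ji.
  by rewrite ji ltnn in ij.
have VE i j : V i j = sigma (enum_val j) (theta ^+ i) by rewrite !mxE rmorphXn.
pose y i := invmx V (enum_rank (1%g : gT)) i.
pose W := \matrix_(j < n, i < n) sigma (enum_val j) (y i).
have WV : W *m V = 1%:M.
  (* Entry (j, k) is the image under the j-th automorphism of the entry of [invmx V *m V] at the
     positions of 1 and of k j^-1. *)
  apply/matrixP => j k; rewrite mxE.
  have -> : (1%:M : 'M[E]_n) j k = sigma (enum_val j) ((invmx V *m V)
      (enum_rank 1%g) (enum_rank (enum_val k * (enum_val j)^-1)%g)).
    rewrite mulVmx // !mxE rmorph_nat (inj_eq enum_rank_inj) [in RHS]eq_sym.
    by rewrite -eq_mulgV1 (inj_eq enum_val_inj) eq_sym.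
  rewrite mxE rmorph_sum; apply: eq_bigr => i _.
  by rewrite rmorphM [W _ _]mxE !VE enum_rankK -sigmaM mulgKV.
exists (fun i => theta ^+ i), y; split=> [g|i j].
  transitivity ((W *m V) (enum_rank g) (enum_rank 1%g)).
    rewrite mxE; apply: eq_bigr => i _.
    by rewrite [W _ _]mxE VE !enum_rankK sigma1 mulrC.
  by rewrite WV mxE (inj_eq enum_rank_inj).
transitivity ((V *m W) i j); last by rewrite (mulmx1C WV) mxE.
rewrite mxE (reindex_onto (@enum_val gT predT) enum_rank) /=; last first.
  by move=> g _; rewrite enum_rankK.
apply: eq_big => [k|k _]; first by rewrite enum_valK eqxx.
by rewrite [W _ _]mxE VE rmorphM.
Qed.

(** Evaluating the relation at the [y i] and pairing with the [sigma h (x i)] leaves only the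
    coefficient at h, by the first identity of [dual_basis]. *)
Lemma dedekind_independence (c : gT -> E) :
  (forall x, \sum_g c g * sigma g x = 0) -> forall g, c g = 0.
Proof.
have [x [y [xy _]]] := dual_basis => c0 h.
transitivity (\sum_i sigma h (x i) * \sum_g c g * sigma g (y i)); last first.
  by apply: big1 => i _; rewrite c0 mulr0.
under eq_bigr do rewrite mulr_sumr.
rewrite exchange_big (bigD1 h) //= [X in _ + X]big1 ?addr0 => [|g gh].
  have := congr1 (sigma h) (xy 1%g); rewrite eqxx rmorph1 rmorph_sum => xy1.
  rewrite -[LHS]mulr1 -xy1 mulr_sumr; apply: eq_bigr => i _.
  by rewrite sigma1 rmorphM mulrCA.
have := congr1 (sigma h) (xy (g * h^-1)%g).
rewrite -eq_mulgV1 (negPf gh) rmorph0 rmorph_sum => xyg.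
rewrite -[RHS](mulr0 (c g)) -[X in _ = _ * X]xyg [RHS]mulr_sumr.
apply: eq_bigr => i _.
by rewrite rmorphM -sigmaM mulgKV mulrCA.
Qed.

Section Descent.
Variables (X : finType) (tau : gT -> {perm X}).
Hypothesis tauM : forall g h, tau (g * h)%g = (tau g * tau h)%g.

Local Notation semilinear_act := (semilinear_act sigma tau).
Variable U : {set {ffun X -> E}}.
Hypothesis U0 : 0 \in U.
Hypothesis UD : forall f h, f \in U -> h \in U -> f + h \in U.
Hypothesis UZ : forall (a : E) f, f \in U -> [ffun x => a * f x] \in U.
Hypothesis Usigma : forall g f, f \in U -> semilinear_act g f \in U.

Definition semilinear_fix :=
  [set f in U | [forall g, semilinear_act g f == f]].

(** Galois descent in counting form: [psi], which takes the traces of the multiples of u by the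
    [y i], and [phi], which recombines with the [x i], are inverse bijections between U and n-tuples
    of fixed elements. Each composite is one of the identities of [dual_basis]. *)
Lemma card_semilinear_fix : #|U| = (#|semilinear_fix| ^ n)%N.
Proof.
have [x [y [xy yx]]] := dual_basis.
have tau1 : tau 1%g = 1%g by apply: (mulgI (tau 1%g)); rewrite -tauM !mulg1.
have Usum (I : finType) (F : I -> {ffun X -> E}) :
  (forall i, F i \in U) -> \sum_i F i \in U.
  by move=> FU; apply: (big_ind (fun f => f \in U)).
have fixP (f : {ffun X -> E}) z g :
    f \in semilinear_fix -> sigma g (f ((tau g)^-1 z)%g) = f z.
  by case/setIdP=> _ /forallP/(_ g)/eqP/ffunP/(_ z); rewrite ffunE.
pose phi (w : {ffun 'I_n -> {ffun X -> E}}) : {ffun X -> E} :=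
  \sum_i [ffun z => x i * w i z].
pose tr (u : {ffun X -> E}) i : {ffun X -> E} :=
  \sum_g semilinear_act g [ffun z => y i * u z].
pose psi (u : {ffun X -> E}) : {ffun 'I_n -> {ffun X -> E}} := [ffun i => tr u i].
pose D := [set w : {ffun 'I_n -> {ffun X -> E}} |
             w \in ffun_on semilinear_fix].
have phiK : {in D, cancel phi psi}.
  move=> w; rewrite inE => /ffun_onP wD.
  apply/ffunP => j; apply/ffunP => z; rewrite ffunE sum_ffunE.
  under eq_bigr => g _ do rewrite !ffunE sum_ffunE mulr_sumr rmorph_sum.
  rewrite exchange_big /= -[RHS]mul1r.
  transitivity (\sum_i (i == j)%:R * w i z); last first.
    rewrite (bigD1 j) //= eqxx big1 ?addr0 // => i /negPf->.
    by rewrite mul0r.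
  apply: eq_bigr => i _; rewrite -yx mulr_suml; apply: eq_bigr => g _.
  by rewrite ffunE -[in RHS](fixP _ z g (wD i)) -rmorphM mulrA (mulrC (y j)).
have psiK : {in U, cancel psi phi}.
  move=> u uU; apply/ffunP => z; rewrite sum_ffunE.
  under eq_bigr => i _ do rewrite !ffunE sum_ffunE mulr_sumr.
  rewrite exchange_big /=.
  transitivity (\sum_g (g == 1%g)%:R * sigma g (u ((tau g)^-1 z)%g)).
    apply: eq_bigr => g _; rewrite -xy mulr_suml; apply: eq_bigr => i _.
    by rewrite !ffunE rmorphM mulrA.
  rewrite (bigD1 1%g) //= eqxx big1 ?addr0 => [|g /negPf->]; last exact: mul0r.
  by rewrite mul1r sigma1 tau1 invg1 perm1.
have phiU : phi @: D \subset U.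
  apply/subsetP => _ /imsetP[w + ->]; rewrite inE => /ffun_onP wD.
  by apply: Usum => i; apply: UZ; case/setIdP: (wD i).
have psiD : psi @: U \subset D.
  apply/subsetP => _ /imsetP[u uU ->]; rewrite inE; apply/ffun_onP => i.
  rewrite ffunE inE Usum => [|g]; last by apply/Usigma/UZ.
  apply/forallP => h; apply/eqP/ffunP => z; rewrite ffunE !sum_ffunE.
  rewrite rmorph_sum [RHS](reindex_inj (mulIg h)); apply: eq_bigr => g _ /=.
  by rewrite !ffunE sigmaM tauM invMg permM.
have cardD : #|D| = (#|semilinear_fix| ^ n)%N.
  by rewrite cardsE card_ffun_on card_ord.
rewrite -cardD; apply/eqP; rewrite eqn_leq; apply/andP; split.
  by rewrite -(card_in_imset (can_in_inj psiK)) subset_leq_card.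
by rewrite -(card_in_imset (can_in_inj phiK)) subset_leq_card.
Qed.

Lemma semilinear_fix_eq0 :
  (forall f, f \in semilinear_fix -> f = 0) -> forall f, f \in U -> f = 0.
Proof.
move=> fix0 f fU.
have le1 : (#|semilinear_fix| <= 1)%N.
  by apply/card_le1_eqP => u w /fix0-> /fix0->.
have : (#|U| <= 1)%N.
  rewrite card_semilinear_fix -(exp1n n) leq_exp2r //.
  by apply/card_gt0P; exists 1%g.
by move/card_le1_eqP => U1; apply: U1.
Qed.
End Descent.
End DualBasis.

(** * Regular subgroups of Perm(G) normalised by translations *)

Section RegularSubgroup.
Variables (gT : finGroupType) (N : {group {perm gT}}).
Hypothesis cardN : #|N| = #|[set: gT]|.
Hypothesis transN : [transitive N, on [set: gT] | 'P].
(** Right multiplication in [gT] is left translation in a Galois group, where the formal product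
    composes in the opposite order. *)
Definition left_translation (g : gT) : {perm gT} := perm (mulIg g).
Local Notation lam := left_translation.
Hypothesis normN : forall g, lam g \in 'N(N)%g.

Lemma regular_transitive x y : exists2 n, n \in N & n x = y.
Proof.
have /atransP/(_ x (in_setT x)) := transN.
have : y \in [set: gT] by rewrite inE.
by move=> + yN; rewrite -yN => /imsetP[n nN ->]; exists n.
Qed.

(** Evaluation at x maps N onto G by transitivity, and the two have the same size. *)
Lemma regular_inj x n n' : n \in N -> n' \in N -> n x = n' x -> n = n'.
Proof.
suff /imset_injP inj : #|[set n x | n : {perm gT} in N]| == #|N|.
  by move=> nN n'N; apply: inj.
rewrite cardN; apply/eqP/eq_card => y; rewrite inE.
by have [m mN <-] := regular_transitive x y; rewrite imset_f.
Qed.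

(** Inverse of the bijection n |-> n(1) from N to G; by transitivity the default is never
    reached. *)
Definition regular_elt x : {perm gT} := odflt 1%g [pick n in N | n 1%g == x].
Local Notation nu := regular_elt.

Lemma regular_eltP x : nu x \in N /\ nu x 1%g = x.
Proof.
rewrite /nu; case: pickP => [n /andP[nN /eqP] //|no].
have [n nN n1] := regular_transitive 1%g x.
by have := no n; rewrite nN n1 eqxx.
Qed.

Lemma regular_eltK n : n \in N -> nu (n 1%g) = n.
Proof.
by move=> nN; have [? ?] := regular_eltP (n 1%g); apply: (@regular_inj 1%g).
Qed.

Lemma left_translationM g h : lam (g * h)%g = (lam g * lam h)%g.
Proof. by apply/permP => x; rewrite permM !permE mulgA. Qed.

Lemma memJ_lam g n : (n ^ lam g)%g \in N = (n \in N).
Proof. exact: memJ_norm. Qed.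

Definition conj_lam g : {perm {perm gT}} := perm (@conjg_inj _ (lam g)).

Lemma conj_lamM g h : conj_lam (g * h)%g = (conj_lam g * conj_lam h)%g.
Proof. by apply/permP => n; rewrite permM !permE left_translationM conjgM. Qed.

Lemma conj_lamV g n : ((conj_lam g)^-1 n = n ^ (lam g)^-1)%g.
Proof. by apply: (@perm_inj _ (conj_lam g)); rewrite permKV permE conjgKV. Qed.

Lemma regular_conj_inj g : injective (fun x => (nu x ^ lam g)%g 1%g).
Proof.
move=> x y xy; have [xN x1] := regular_eltP x; have [yN y1] := regular_eltP y.
suff xyE : nu x = nu y by rewrite -x1 xyE y1.
apply: (@conjg_inj _ (lam g)).
by apply: regular_inj xy; rewrite memJ_lam.
Qed.

(* Conjugation by lambda g on N, transported to G along n |-> n(1). *)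
Definition regular_conj g : {perm gT} := perm (@regular_conj_inj g).

Lemma regular_conjE g n : n \in N -> regular_conj g (n 1%g) = (n ^ lam g)%g 1%g.
Proof. by move=> nN; rewrite permE regular_eltK. Qed.

Lemma regular_conjM g h :
  regular_conj (g * h)%g = (regular_conj g * regular_conj h)%g.
Proof.
apply/permP => x; have [xN x1] := regular_eltP x.
by rewrite -x1 permM !regular_conjE ?memJ_lam // left_translationM conjgM.
Qed.

(** Writing n(x) as the value at 1 of a product in N reduces this to multiplicativity of
    conjugation. It puts [regular_conj] on the same footing as left translation in
    [perm_act_semilinear]. *)
Lemma regular_conj_equivariant g n x : n \in N ->
  regular_conj g (n x) = (n ^ lam g)%g (regular_conj g x).
Proof.
move=> nN; have [xN x1] := regular_eltP x.
have -> : n x = (nu x * n)%g 1%g by rewrite permM x1.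
by rewrite regular_conjE ?groupM // conjMg permM -regular_conjE // x1.
Qed.

Lemma lam_equivariant g (n : {perm gT}) x : lam g (n x) = (n ^ lam g)%g (lam g x).
Proof. by rewrite permJ. Qed.

(** * The permutation module Map(G, E) and its semilinear structures *)

Section PermModule.
Variables (E : fieldType) (sigma : gT -> {rmorphism E -> E}).

Definition perm_act (b : {ffun {perm gT} -> E}) (f : {ffun gT -> E}) :
    {ffun gT -> E} :=
  [ffun x => \sum_(n in N) b n * f (n^-1 x)%g].

(** Valid for every action on G that conjugates N as left translation does, hence for both
    G-structures on Map(G, E): the sum over N is reindexed by conjugation. *)
Lemma perm_act_semilinear (tau : gT -> {perm gT}) g b f :
    (forall n x, n \in N -> tau g (n x) = (n ^ lam g)%g (tau g x)) ->
  semilinear_act sigma tau g (perm_act b f) =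
  perm_act (semilinear_act sigma conj_lam g b) (semilinear_act sigma tau g f).
Proof.
move=> tauN; apply/ffunP => x; rewrite !ffunE rmorph_sum.
rewrite [RHS](reindex_inj (@conjg_inj _ (lam g))).
apply: eq_big => [n|n nN] /=; first by rewrite memJ_lam.
rewrite !ffunE conj_lamV conjgK rmorphM; congr (_ * sigma g (f _)).
apply: (@perm_inj _ (tau g)); rewrite tauN ?groupV // !permKV.
by rewrite conjVg.
Qed.

Lemma perm_act0r b : perm_act b 0 = 0.
Proof. by apply/ffunP => x; rewrite !ffunE big1 // => n _; rewrite ffunE mulr0. Qed.

Lemma perm_actD b f h : perm_act b (f + h) = perm_act b f + perm_act b h.
Proof.
apply/ffunP => x; rewrite !ffunE -big_split; apply: eq_bigr => n _.
by rewrite ffunE mulrDr.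
Qed.

Lemma perm_actZ b a (f : {ffun gT -> E}) :
  perm_act b [ffun x => a * f x] = [ffun x => a * perm_act b f x].
Proof.
apply/ffunP => x; rewrite !ffunE mulr_sumr; apply: eq_bigr => n _.
by rewrite ffunE mulrCA.
Qed.

Lemma perm_act0l f : perm_act 0 f = 0.
Proof. by apply/ffunP => x; rewrite !ffunE big1 // => n _; rewrite ffunE mul0r. Qed.

Lemma perm_actDl b c f : perm_act (b + c) f = perm_act b f + perm_act c f.
Proof.
apply/ffunP => x; rewrite !ffunE -big_split; apply: eq_bigr => n _.
by rewrite ffunE mulrDl.
Qed.

Lemma perm_actZl a (b : {ffun {perm gT} -> E}) f :
  perm_act [ffun n => a * b n] f = [ffun x => a * perm_act b f x].
Proof.
apply/ffunP => x; rewrite !ffunE mulr_sumr; apply: eq_bigr => n _.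
by rewrite ffunE mulrA.
Qed.

Lemma semilinear_act0 (X : finType) (tau : gT -> {perm X}) g :
  semilinear_act sigma tau g 0 = 0.
Proof. by apply/ffunP => x; rewrite !ffunE rmorph0. Qed.

(** By regularity only n sends 1 to n(1), so the action on the delta function at 1 displays all the
    coefficients of b on N. *)
Lemma perm_act_delta b n : n \in N ->
  perm_act b [ffun x => (x == 1%g)%:R] (n 1%g) = b n.
Proof.
move=> nN; rewrite ffunE (bigD1 n) //= ffunE permK eqxx mulr1 big1 ?addr0 //.
move=> m /andP[mN mn]; rewrite ffunE; case: eqP => [e|]; last by rewrite mulr0.
case/eqP: mn; apply: (@regular_inj 1%g) => //.
by rewrite -{1}e permKV.
Qed.

Lemma perm_actB b c f : perm_act (b - c) f = perm_act b f - perm_act c f.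
Proof.
rewrite perm_actDl; congr (_ + _).
apply/ffunP => x; rewrite !ffunE -sumrN; apply: eq_bigr => n _.
by rewrite ffunE mulNr.
Qed.

(** Identifies E with the functions fixed under the structure given by left translation; evaluating
    [perm_act] on it at 1 gives the Hopf-Galois action. *)
Definition orbit_fun x : {ffun gT -> E} := [ffun g => sigma g x].

Hypothesis sigmaM : forall g h x, sigma (g * h)%g x = sigma h (sigma g x).

Lemma orbit_fun_fixed x g : semilinear_act sigma lam g (orbit_fun x) = orbit_fun x.
Proof.
apply/ffunP => h; rewrite !ffunE -sigmaM; congr (sigma _ x).
by rewrite -[RHS](permKV (lam g)) [RHS]permE.
Qed.

Lemma fixed_orbit_fun f :
  (forall g, semilinear_act sigma lam g f = f) -> f = orbit_fun (f 1%g).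
Proof.
move=> ffix; apply/ffunP => x; rewrite [RHS]ffunE.
have /ffunP/(_ x) <- := ffix x; rewrite ffunE; congr (sigma x (f _)).
by apply: (@perm_inj _ (lam x)); rewrite permKV permE mul1g.
Qed.

(** A fixed b preserves the fixed functions, and these are determined by their value at 1. *)
Lemma perm_act_orbit_fun b x :
    (forall g, semilinear_act sigma conj_lam g b = b) ->
  perm_act b (orbit_fun x) = orbit_fun (perm_act b (orbit_fun x) 1%g).
Proof.
move=> bfix; apply: fixed_orbit_fun => g.
rewrite perm_act_semilinear ?bfix ?orbit_fun_fixed // => n y _.
exact: lam_equivariant.
Qed.
End PermModule.

(** * A normal basis over a finite field *)

Section FiniteNormalBasis.
Variables (E : finFieldType) (sigma : gT -> {rmorphism E -> E}).
Hypothesis sigma1 : forall x, sigma 1%g x = x.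
Hypothesis sigmaM : forall g h x, sigma (g * h)%g x = sigma h (sigma g x).
Hypothesis sigma_faithful : forall g, sigma g =1 id -> g = 1%g.
Local Notation LN := {ffun {perm gT} -> E}.
Local Notation W := {ffun gT -> E}.

Definition fixed_algebra : {set LN} :=
  [set b : LN | [forall n, (n \notin N) ==> (b n == 0)] &&
                [forall g, semilinear_act sigma conj_lam g b == b]].

(** Holds vacuously outside E[N]^G, so that I may range over arbitrary sets of functions. *)
Definition kills (b : LN) (f : W) := (b \in fixed_algebra) ==> (perm_act b f == 0).

(** The functions killed by I form a subspace stable under G, because the elements of E[N]^G are
    fixed; descent counts its fixed points. The left side does not depend on [tau], which is what
    allows two structures to be compared. *)
Lemma killed_semilinear (tau : gT -> {perm gT}) (I : {set LN}) :
    (forall g h, tau (g * h)%g = (tau g * tau h)%g) ->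
    (forall g n x, n \in N -> tau g (n x) = (n ^ lam g)%g (tau g x)) ->
  #|[set f : W | [forall b in I, kills b f]]| =
  (#|[set f in [set f : W | [forall g, semilinear_act sigma tau g f == f]] |
      [forall b in I, kills b f]]| ^ #|gT|)%N.
Proof.
move=> tauM tauN; set U := [set f : W | [forall b in I, kills b f]].
have UP f : reflect
    (forall b, b \in I -> b \in fixed_algebra -> perm_act b f = 0) (f \in U).
  rewrite inE; apply: (iffP forall_inP) => [kf b bI bB|kf b bI].
    by have /implyP/(_ bB)/eqP := kf b bI.
  by apply/implyP => bB; rewrite kf.
rewrite (@card_semilinear_fix _ _ _ sigma1 sigmaM sigma_faithful _ _ tauM U).
- by congr (_ ^ _)%N; apply: eq_card => f; rewrite !inE andbC.
- by apply/UP => b _ _; rewrite perm_act0r.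
- move=> f h /UP fU /UP hU; apply/UP => b bI bB.
  by rewrite perm_actD fU ?hU ?addr0.
- move=> a f /UP fU; apply/UP => b bI bB; rewrite perm_actZ fU //.
  by apply/ffunP => x; rewrite !ffunE mulr0.
move=> g f /UP fU; apply/UP => b bI bB.
have := bB; rewrite inE => /andP[_ /forallP/(_ g)/eqP <-].
by rewrite -perm_act_semilinear ?fU ?semilinear_act0 // => n x; apply: tauN.
Qed.

(** Downward induction on I: the elements annihilated by I are those with exact annihilator I
    together with those whose exact annihilator is larger, and the latter are already counted. *)
Lemma exact_annihilator_card (S T : finType) (r : S -> T -> bool)
    (D1 D2 : {set T}) :
    (forall I : {set S}, #|[set f in D1 | [forall b in I, r b f]]| =
                         #|[set f in D2 | [forall b in I, r b f]]|) ->
  forall I : {set S}, #|[set f in D1 | [set b | r b f] == I]| =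
                      #|[set f in D2 | [set b | r b f] == I]|.
Proof.
move=> eqI I; have [k] := ubnP #|~: I|; elim: k I => // k IHk I ltIk.
pose ann f := [set b | r b f].
have split (D : {set T}) : #|[set f in D | [forall b in I, r b f]]| =
    (#|[set f in D | ann f == I]| +
     \sum_(J : {set S} | I \proper J) #|[set f in D | ann f == J]|)%N.
  rewrite -sum1_card (partition_big ann (fun J => I \subset J)) /=.
    rewrite (bigD1 I) //=; congr addn.
      rewrite -sum1_card; apply: eq_bigl => f; rewrite !inE.
      case: (f \in D) => //=; apply: andb_idl => /eqP <-.
      by apply/forall_inP => b; rewrite inE.
    apply: eq_big => [J|J].
      by rewrite properEneq andbC eq_sym.
    move=> /andP[IJ _]; rewrite -sum1_card; apply: eq_bigl => f; rewrite !inE.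
    case: (f \in D) => //=; apply: andb_idl => /eqP fJ.
    apply/forall_inP => b bI; have := subsetP IJ b bI.
    by rewrite -fJ inE.
  move=> f; rewrite inE => /andP[_ /forall_inP fI].
  by apply/subsetP => b /fI; rewrite inE.
have := eqI I; rewrite !split => /eqP; rewrite (eq_bigr (fun J =>
   #|[set f in D2 | ann f == J]|)) ?eqn_add2r => [/eqP //|J IJ].
apply: IHk; rewrite -ltnS; apply: leq_trans ltIk; rewrite ltnS.
by apply: proper_card; rewrite properC.
Qed.

(* The G-equivariant structures lambda and conjugation by lambda on Map(G, E)
   have E and E[N]^G as fixed points; over E they give the same E[N]-module, so
   any subset of E[N]^G has annihilators of the same size in both. By inclusion-
   exclusion, the sets of elements with a given exact annihilator also have the
   same size; the unit of E[N]^G has annihilator 0. *)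
Lemma finField_hopf_normal_basis : exists m : E, forall b : LN,
    (forall n, n \notin N -> b n = 0) ->
    (forall x, \sum_(n in N) b n * sigma (n^-1%g x) m = 0) ->
  b = 0.
Proof.
pose D (tau : gT -> {perm gT}) :=
  [set f : W | [forall g, semilinear_act sigma tau g f == f]].
have eqD (I : {set LN}) : #|[set f in D lam | [forall b in I, kills b f]]| =
                          #|[set f in D regular_conj | [forall b in I, kills b f]]|.
  apply/eqP; rewrite -(@eqn_exp2r _ _ #|gT|); last first.
    by apply/card_gt0P; exists 1%g.
  rewrite /D -!killed_semilinear //.
  - exact: regular_conjM.
  - by move=> g n x; apply: regular_conj_equivariant.
  - exact: left_translationM.
  - by move=> g n x _; apply: lam_equivariant.
(* The delta function at 1, fixed under [regular_conj] because conjugation fixes the identity of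
   N. *)
pose e : W := [ffun x => (x == 1%g)%:R].
have eD : e \in D regular_conj.
  rewrite inE; apply/forallP => g; apply/eqP/ffunP => x; rewrite !ffunE rmorph_nat.
  congr (nat_of_bool _)%:R.
  rewrite -(inj_eq (@perm_inj _ (regular_conj g))) permKV.
  rewrite -[X in regular_conj g X](perm1 (1%g : gT)) regular_conjE //.
  by rewrite conj1g perm1.
have := exact_annihilator_card eqD [set b | kills b e].
set ann := [set b | kills b e].
have : (0 < #|[set f in D regular_conj | [set b | kills b f] == ann]|)%N.
  by apply/card_gt0P; exists e; rewrite inE eD eqxx.
move=> + eq_card; rewrite -eq_card => /card_gt0P[f].
rewrite inE => /andP[fD /eqP annf].
have kf b : b \in fixed_algebra -> perm_act b f = 0 -> b = 0.
  move=> bB bf; have : b \in ann by rewrite -annf inE /kills bf eqxx implybT.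
  rewrite inE /kills bB => /eqP be; apply/ffunP => n; rewrite ffunE.
  have := bB; rewrite inE => /andP[/forallP/(_ n)/implyP bN _].
  have [nN|/bN/eqP //] := boolP (n \in N).
  by rewrite -(perm_act_delta b nN) -/e be ffunE.
have fE : f = orbit_fun sigma (f 1%g).
  apply: fixed_orbit_fun => g.
  by move: fD; rewrite inE => /forallP/(_ g)/eqP.
exists (f 1%g).
(* Passage from E[N]^G to E[N]: the annihilator of f in E[N] is stable under G and has no nonzero
   fixed point by [kf], so descent makes it 0. *)
pose U : {set LN} := [set b : LN | [forall n, (n \notin N) ==> (b n == 0)] &&
                       (perm_act b f == 0)].
move=> b bN bf; suff : b \in U.
  apply: (semilinear_fix_eq0 sigma1 sigmaM sigma_faithful conj_lamM).
  - rewrite inE perm_act0l eqxx andbT; apply/forallP => n; apply/implyP => _.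
    by rewrite ffunE.
  - move=> u w; rewrite !inE.
    move=> /andP[/forallP uN /eqP uf] /andP[/forallP wN /eqP wf].
    rewrite perm_actDl uf wf addr0 eqxx andbT; apply/forallP => n.
    apply/implyP => nN; rewrite ffunE (eqP (implyP (uN n) nN)).
    by rewrite (eqP (implyP (wN n) nN)) addr0.
  - move=> a u; rewrite !inE => /andP[/forallP uN /eqP uf].
    rewrite perm_actZl uf; apply/andP; split; last first.
      by apply/eqP/ffunP => x; rewrite !ffunE mulr0.
    apply/forallP => n; apply/implyP => nN; rewrite ffunE.
    by rewrite (eqP (implyP (uN n) nN)) mulr0.
  - move=> g u; rewrite !inE => /andP[/forallP uN /eqP uf].
    apply/andP; split.
      apply/forallP => n; apply/implyP => nN; rewrite ffunE conj_lamV.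
      rewrite (eqP (implyP (uN _) _)) ?rmorph0 //.
      by rewrite -(memJ_lam g) conjgKV.
    have := fD; rewrite inE => /forallP/(_ g)/eqP <-.
    rewrite -perm_act_semilinear ?uf ?semilinear_act0 // => n x _.
    exact: lam_equivariant.
  - move=> u; rewrite !inE => /andP[/andP[uN /eqP uf] ufix]; apply: kf => //.
    by rewrite inE uN.
rewrite inE; apply/andP; split.
  by apply/forallP => n; apply/implyP => /bN->.
apply/eqP/ffunP => x; rewrite !ffunE -[RHS](bf x).
by apply: eq_bigr => n _; rewrite [in LHS]fE ffunE.
Qed.
End FiniteNormalBasis.
End RegularSubgroup.

(** * p-adic integers *)

Section PadicDigits.
Variables (p : nat) (hp : prime p).
Local Notation Zp := (padic_int hp).
Local Notation q n := ((p ^ n)%N%:Z).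

Lemma padic_digit0 (x : Zp) : x 0%N = 0.
Proof. by rewrite padic_compat modz1. Qed.

Lemma padic_digitD (x y : Zp) n : (x + y) n = ((x n + y n) %% q n)%Z.
Proof. by []. Qed.

Lemma padic_digitM (x y : Zp) n : (x * y) n = ((x n * y n) %% q n)%Z.
Proof. by []. Qed.

Lemma padic_digitN (x : Zp) n : (- x) n = ((- x n) %% q n)%Z.
Proof. by []. Qed.

Lemma padic_digit1 n : (1 : Zp) n = (1 %% q n)%Z.
Proof. by []. Qed.

Lemma padic_digit_nat m n : (m%:R : Zp) n = (m%:Z %% q n)%Z.
Proof.
elim: m => [|m IHm]; first by [].
by rewrite -addn1 natrD padic_digitD IHm padic_digit1 modzDm PoszD.
Qed.

Lemma padic_digit_bounds (x : Zp) n : 0 <= x n < q n.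
Proof.
have q0 : 0 < q n by rewrite ltz_nat expn_gt0 prime_gt0.
by rewrite -padic_modz modz_ge0 ?lt0r_neq0 //= ltz_pmod.
Qed.

Lemma padic_eq0P (x : Zp) : (forall n, x n = 0) -> x = 0.
Proof. by move=> x0; apply: padic_eq => n; rewrite x0 (padic_digit_nat 0) mod0z. Qed.

(** Dividing by p^n costs n digits of precision, so the k-th residue of the quotient is read from
    the residue of x modulo p^(n+k). *)
Lemma padic_dvd (x : Zp) n : x n = 0 -> exists y : Zp, x = p%:R ^+ n * y.
Proof.
move=> xn0.
have qn0 k : q k != 0 by rewrite -lt0n expn_gt0 prime_gt0.
have dv k : (q n %| x (n + k)%N)%Z.
  by apply/dvdz_mod0P; rewrite -(padic_modz_le x (leq_addr k n)).
pose f k := (x (n + k)%N %/ q n)%Z.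
have fE k : f k * q n = x (n + k)%N by rewrite /f divzK.
have cf k : (f k.+1 = f k %[mod q k])%Z.
  apply/eqP; rewrite eqz_mod_dvd -(dvdz_mul2r (qn0 n)).
  rewrite mulrBl !fE -PoszM -expnD (addnC k n) addnS -eqz_mod_dvd.
  by apply/eqP; rewrite (padic_compat_mod x).
exists (padic_trunc hp cf); apply: padic_eq => k.
rewrite -natrX padic_digitM padic_digit_nat /= modzMml modzMmr mulrC fE.
by rewrite -(padic_modz_le x (leq_addl n k)).
Qed.

Lemma padic_dvd_digit n (y : Zp) : (p%:R ^+ n * y) n = 0.
Proof. by rewrite -natrX padic_digitM padic_digit_nat modzz mul0r mod0z. Qed.

(** Bezout coefficients invert z modulo every p^k, and they are compatible because inverses modulo
    p^k are unique. *)
Lemma padic_unitE (z : Zp) : z 1%N != 0 -> z \is a GRing.unit.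
Proof.
move=> z1.
have zco k : coprimez (z k) (q k).
  case: k => [|k]; first by rewrite /coprimez gcdz1.
  rewrite coprimezE coprimeXr // coprime_sym.
  rewrite prime_coprime //; apply: contra z1 => pz.
  rewrite (padic_modz_le z (isT : 0 < k.+1)%N) expn1; apply/eqP/dvdz_mod0P.
  by rewrite dvdzE.
pose f k := (egcdz (z k) (q k)).1.
have fE k : (f k * z k = 1 %[mod q k])%Z.
  rewrite /f; case: egcdzP => u v + _ /=; rewrite (eqP (zco k)) => <-.
  by rewrite addrC modzMDl.
have cf k : (f k.+1 = f k %[mod q k])%Z.
  apply/eqP; rewrite eqz_mod_dvd -(@Gauss_dvdzl _ _ (z k)); last first.
    by rewrite coprimez_sym.
  rewrite mulrBl -eqz_mod_dvd fE; apply/eqP.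
  rewrite -modzMmr -padic_compat_mod modzMmr.
  by rewrite -(modz_pow p (f k.+1 * z k.+1) (leqnSn k)) fE modz_pow.
apply/unitrPr; exists (padic_trunc hp cf); apply: padic_eq => k.
by rewrite padic_digitM /= modzMmr mulrC fE.
Qed.
End PadicDigits.

(** * Rational-valued valuations and uniqueness of the extension *)

Section RatValuation.
Variables (L : fieldType) (v : L -> rat).

Definition vge (r : rat) (x : L) := (x == 0) || (r <= v x).

Hypothesis vM : forall x y, x != 0 -> y != 0 -> v (x * y) = v x + v y.
Hypothesis vD : forall x y, x != 0 -> y != 0 -> x + y != 0 ->
  Num.min (v x) (v y) <= v (x + y).

Lemma valuation1 : v 1 = 0.
Proof. by apply: (addrI (v 1)); rewrite -vM ?oner_eq0 // mulr1 addr0. Qed.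

Lemma valuationN x : v (- x) = v x.
Proof.
have [->|x0] := eqVneq x 0; first by rewrite oppr0.
rewrite -mulN1r vM ?oppr_eq0 ?oner_eq0 //.
have := vM (x := -1) (y := -1); rewrite mulrNN mulr1 valuation1 oppr_eq0 oner_eq0.
by move=> /(_ isT isT); lra.
Qed.

Lemma valuationX x n : x != 0 -> v (x ^+ n) = v x *+ n.
Proof.
move=> x0; elim: n => [|n IHn]; first by rewrite valuation1.
by rewrite exprS vM ?expf_neq0 // IHn mulrS.
Qed.

Lemma valuationV x : x != 0 -> v x^-1 = - v x.
Proof.
move=> x0; apply/eqP; rewrite -addr_eq0 -vM ?invr_eq0 // mulVf //.
by rewrite valuation1.
Qed.

Lemma vge0 r : vge r 0. Proof. by rewrite /vge eqxx. Qed.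

Lemma vgeD r x y : vge r x -> vge r y -> vge r (x + y).
Proof.
rewrite /vge; have [->|x0] /= := eqVneq x 0; first by rewrite add0r.
have [->|y0] /= := eqVneq y 0; first by rewrite addr0 (negPf x0).
have [//|xy0] /= := eqVneq (x + y) 0 => rx ry.
by apply: le_trans (vD x0 y0 xy0); rewrite le_min rx.
Qed.

Lemma vgeN r x : vge r (- x) = vge r x.
Proof. by rewrite /vge oppr_eq0 valuationN. Qed.

Lemma vgeB r x y : vge r x -> vge r y -> vge r (x - y).
Proof. by move=> rx ry; rewrite vgeD ?vgeN. Qed.

Lemma vgeM r s x y : vge r x -> vge s y -> vge (r + s) (x * y).
Proof.
rewrite /vge mulf_eq0; have [//|x0] /= := eqVneq x 0.
by have [//|y0] /= := eqVneq y 0 => rx sy; rewrite vM // lerD.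
Qed.

Lemma vge_le r s x : s <= r -> vge r x -> vge s x.
Proof. by rewrite /vge => sr /orP[->//|/(le_trans sr)->]; rewrite orbT. Qed.

Lemma vge_sum r (I : Type) (s : seq I) (P : pred I) (F : I -> L) :
  (forall i, P i -> vge r (F i)) -> vge r (\sum_(i <- s | P i) F i).
Proof. by move=> rF; apply: (big_ind (vge r)) => //; [apply: vge0|apply: vgeD]. Qed.

Lemma vge1 : vge 0 1. Proof. by rewrite /vge valuation1 lexx orbT. Qed.

Lemma vgeM0 x y : vge 0 x -> vge 0 y -> vge 0 (x * y).
Proof. by move=> x0 y0; rewrite -[0]addr0 vgeM. Qed.

Lemma vge_prod (I : Type) (s : seq I) (P : pred I) (F : I -> L) :
  (forall i, P i -> vge 0 (F i)) -> vge 0 (\prod_(i <- s | P i) F i).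
Proof. by move=> F0; apply: (big_ind (vge 0)) => //; [apply: vge1|apply: vgeM0]. Qed.

Lemma vge_eq0 c x : (forall n : nat, vge (n%:R + c) x) -> x = 0.
Proof.
move=> nx; apply/eqP; apply: contraT => x0.
have /archi_boundP := normr_ge0 (v x - c); set n := Num.bound _ => ltn.
have := nx n; rewrite /vge (negPf x0) /= => le.
have := ler_norm (v x - c); move: ltn le; lra.
Qed.

End RatValuation.

Section PadicPrimitive.
Variables (p : nat) (hp : prime p).
Local Notation Zp := (padic_int hp).

Lemma padic_nz_digit (x : Zp) : x != 0 -> exists2 n, x n = 0 & x n.+1 != 0.
Proof.
move=> x0; have ex : exists n, x n.+1 != 0.
  apply: contrapT => nex; case/eqP: x0; apply: padic_eq0P => -[|n].
    exact: padic_digit0.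
  by apply: contrapT => /eqP xn; apply: nex; exists n.
case: (ex_minnP ex) => n xn min; exists n => //.
case: n min {xn} => [|n] min; first exact: padic_digit0.
by apply/eqP; apply: contraT => /min; rewrite ltnn.
Qed.

End PadicPrimitive.

(** * Coordinates over Z_p and comparison of valuations *)

Section NormEquivalence.
Variables (p : nat) (hp : prime p).
Local Notation Zp := (padic_int hp).
Variables (L : fieldType) (iota : {rmorphism Zp -> L}).
Hypothesis iota_inj : injective iota.
Variables (I : finType) (e : I -> L).
Definition padic_comb (a : I -> Zp) : L := \sum_i iota (a i) * e i.
Local Notation S := padic_comb.
Hypothesis free_e : forall a : I -> Zp, S a = 0 -> forall i, a i = 0.

(** Not divisible by p: index 1 is the residue modulo p, index 0 being the trivial residue modulo
    1. *)
Definition padic_primitive (a : I -> Zp) := exists i, a i 1%N != 0.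

Lemma padic_combB a b : S (fun i => a i - b i) = S a - S b.
Proof.
rewrite -[RHS]sumrB; apply: eq_bigr => i _.
by rewrite rmorphB mulrBl.
Qed.

Lemma padic_combZ c a : S (fun i => c * a i) = iota c * S a.
Proof. by rewrite mulr_sumr; apply: eq_bigr => i _; rewrite rmorphM mulrA. Qed.

Section OneValuation.
Variable v : L -> rat.
Hypothesis vM : forall x y, x != 0 -> y != 0 -> v (x * y) = v x + v y.
Hypothesis vD : forall x y, x != 0 -> y != 0 -> x + y != 0 ->
  Num.min (v x) (v y) <= v (x + y).
Hypothesis v_iota : forall (x : Zp) n, x n = 0 -> x n.+1 != 0 ->
  v (iota x) = n%:R.


Lemma ltn_psq : (p < p ^ 2)%N.
Proof. by rewrite -{1}(expn1 p) ltn_exp2l ?prime_gt1. Qed.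

Lemma val_p : v (iota p%:R) = 1.
Proof.
rewrite (@v_iota _ 1%N) // padic_digit_nat; first by rewrite expn1 modzz.
rewrite modz_small; last by rewrite lez_nat ltz_nat ltn_psq.
by rewrite eqz_nat -lt0n prime_gt0.
Qed.

Lemma iota_eq0 x : (iota x == 0) = (x == 0).
Proof. by rewrite -(rmorph0 iota) (inj_eq iota_inj). Qed.

Lemma vge_iota x : vge v 0 (iota x).
Proof.
rewrite /vge iota_eq0; have [//|x0] /= := eqVneq x 0.
by have [n xn xn1] := padic_nz_digit x0; rewrite (v_iota xn xn1) ler0n.
Qed.

Lemma iota_p_neq0 n : iota (p%:R ^+ n) != 0.
Proof.
rewrite rmorphXn expf_neq0 // iota_eq0; apply/eqP => p0.
have := val_p; have := padic_digit_nat hp p 2.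
rewrite p0 -[0]/(0%:R) padic_digit_nat mod0z modz_small; last first.
  by rewrite lez_nat ltz_nat ltn_psq.
by case=> p00; have := prime_gt0 hp; lia.
Qed.

Lemma val_pX n : v (iota (p%:R ^+ n)) = n%:R.
Proof.
by rewrite rmorphXn valuationX ?val_p // -(expr1 (iota _)) -rmorphXn iota_p_neq0.
Qed.

Lemma padic_comb_bounded_below : exists c, forall a, vge v c (S a).
Proof.
exists (\big[Num.min/0]_i v (e i)) => a; apply: vge_sum => // i _.
rewrite -[X in vge v X]add0r; apply: vgeM => //; first exact: vge_iota.
by rewrite /vge bigmin_le_cond // orbT.
Qed.

(* Compactness of Z_p^I: if primitive vectors had combinations of arbitrarily
   large valuation, Koenig's lemma on the tree of their digit sequences would
   give a nontrivial relation between the e i. *)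
Lemma padic_comb_bounded_above :
  exists C : nat, forall a, padic_primitive a -> ~ vge v C%:R (S a).
Proof.
apply: contrapT => noC.
(* Nodes of the tree: residue vectors modulo p^n that lift to primitive vectors whose combinations
   have arbitrarily large valuation. *)
pose good n (t : I -> int) := forall C : nat, exists a,
  [/\ padic_primitive a, forall i, a i n = t i & vge v C%:R (S a)].
have good0 : good 0%N (fun=> 0).
  move=> C; apply: contrapT => noa; apply: noC; exists C => a pa Ca.
  by apply: noa; exists a; split=> // i; rewrite padic_digit0.
have goodS n t : good n t -> exists t', good n.+1 t' /\
    forall i, t i = (t' i %% (p ^ n)%N%:Z)%Z.
  move=> gt; apply: contrapT => not'.
  (* If no lift of t modulo p^(n+1) were good, each of the finitely many lifts would have its own
     bound, and their maximum would contradict that t is good. *)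
  have /choice[C CP] (u : {ffun I -> 'I_(p ^ n.+1)}) : exists C : nat, forall a,
      padic_primitive a -> (forall i, a i n = t i) ->
      (forall i, a i n.+1 = (u i)%:Z) -> ~ vge v C%:R (S a).
    apply: contrapT => nC; apply: not'; exists (fun i => (u i)%:Z); split.
      move=> C; apply: contrapT => noa; apply: nC; exists C => a pa at_ au Ca.
      by apply: noa; exists a.
    move=> i; apply: contrapT => tu; apply: nC; exists 0%N => a _ at_ au _.
    by apply: tu; rewrite -at_ -au padic_compat.
  have [a [pa at_ Ca]] := gt (\max_u C u)%N.
  have lta i : (`|a i n.+1| < p ^ n.+1)%N.
    have /andP[a0 alt] := padic_digit_bounds (a i) n.+1.
    by rewrite -ltz_nat gez0_abs.
  pose u : {ffun I -> 'I_(p ^ n.+1)} := [ffun i => Ordinal (lta i)].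
  apply: (CP u a) => // [i|].
    by rewrite ffunE /= gez0_abs //; case/andP: (padic_digit_bounds (a i) n.+1).
  by apply: vge_le Ca; rewrite ler_nat leq_bigmax.
pose step n (t : {t | good n t}) : {t' | good n.+1 t'} :=
  let w := cid (goodS n (sval t) (svalP t)) in exist _ (sval w) (svalP w).1.
pose T := nat_rect (fun n => {t | good n t}) (exist _ _ good0) step.
have Tc n i : sval (T n) i = (sval (T n.+1) i %% (p ^ n)%N%:Z)%Z.
  by rewrite /T /= -/T; case: cid => t' [].
pose alpha i := PadicInt hp (fun n => Tc n i).
have [c cP] := padic_comb_bounded_below.
have Sa0 : S alpha = 0.
  apply: (@vge_eq0 _ v (Num.min c 0)) => n.
  have [a [pa an Sa]] := svalP (T n) n.
  have /choice[b bP] i : exists b, alpha i - a i = p%:R ^+ n * b.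
    apply: padic_dvd; rewrite padic_digitD padic_digitN an /=.
    by rewrite modzDmr subrr mod0z.
  rewrite -(subrK (S a) (S alpha)); apply: vgeD => //; last first.
    by apply: vge_le Sa; rewrite gerDl ge_min lexx orbT.
  rewrite -padic_combB (_ : (fun i => _) = (fun i => p%:R ^+ n * b i)); last first.
    by apply: funext.
  rewrite padic_combZ; apply: (@vge_le _ _ (n%:R + c)).
    by rewrite lerD2l ge_min lexx.
  by apply: vgeM => //; rewrite /vge val_pX lexx orbT.
(* At level 1 the limit agrees with a primitive vector, so it is not zero. *)
have [a [[i ai] a1 _]] := svalP (T 1%N) 0%N.
have /(congr1 (fun x : Zp => x 1%N)) := free_e Sa0 i.
rewrite -[0]/(0%:R) padic_digit_nat mod0z /= => T1.
by case/eqP: ai; rewrite a1.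
Qed.

Lemma padic_primitive_part (a : I -> Zp) : (exists i, a i != 0) ->
  exists j b, padic_primitive b /\ forall i, a i = p%:R ^+ j * b i.
Proof.
move=> [i ai]; have ex : exists n, [exists i, a i n.+1 != 0].
  by have [n _ an] := padic_nz_digit ai; exists n; apply/existsP; exists i.
case: (ex_minnP ex) => j /existsP[k ak] min; exists j.
have /choice[b bP] l : exists b, a l = p%:R ^+ j * b.
  apply: padic_dvd; case: j min {ak} => [|j] min; first exact: padic_digit0.
  apply/eqP; apply: contraT => al; have /min : [exists i, a i j.+1 != 0].
    by apply/existsP; exists l.
  by rewrite ltnn.
exists b; split=> //; exists k; apply: contra_neq ak => bk.
have [y yP] := padic_dvd bk.
by rewrite bP yP expr1 mulrA -exprSr padic_dvd_digit.
Qed.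

Hypothesis span_e : forall x, exists d a, d != 0 /\ iota d * x = S a.

(** The denominator of x is a power of p times a unit; the unit is absorbed into the coordinates,
    from which the largest common power of p is then extracted. *)
Lemma padic_normal_form x : x != 0 -> exists j k a,
  padic_primitive a /\ iota (p%:R ^+ k) * x = iota (p%:R ^+ j) * S a.
Proof.
move=> x0; have [d [a [d0 dx]]] := span_e x.
have [k dk dk1] := padic_nz_digit d0; have [u dE] := padic_dvd dk.
have uU : u \is a GRing.unit.
  apply: padic_unitE; apply: contra_neq dk1 => u1.
  have [y uE] := padic_dvd u1.
  by rewrite dE uE expr1 mulrA -exprSr padic_dvd_digit.
have [|j [b [pb bP]]] := @padic_primitive_part (fun i => u^-1 * a i).
  apply: contrapT => na; have : iota d * x != 0 by rewrite mulf_neq0 ?iota_eq0.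
  case/eqP; rewrite dx /padic_comb big1 // => i _.
  suff -> : a i = 0 by rewrite rmorph0 mul0r.
  apply: contrapT => /eqP ai; apply: na; exists i.
  by rewrite mulf_neq0 ?invr_eq0 //; apply: contraTneq uU => ->; rewrite unitr0.
exists j, k, b; split=> //; rewrite -padic_combZ.
rewrite -(_ : (fun i => u^-1 * a i) = (fun i => p%:R ^+ j * b i)); last first.
  exact: funext.
rewrite padic_combZ -dx dE rmorphM !mulrA -!rmorphM /=.
by rewrite mulrAC mulVr // mul1r.
Qed.


(** In normal form v(x) = j - k + v(S a) with v(S a) < C, so integrality forces k <= j + C: the
    valuation ring lies in p^-C times the lattice spanned by the [e i]. *)
Lemma padic_lattice_bound : exists C : nat, forall x, vge v 0 x ->
  exists a, iota (p%:R ^+ C) * x = S a.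
Proof.
have [C CP] := padic_comb_bounded_above; exists C => x xO.
have [->|x0] := eqVneq x 0.
  exists (fun=> 0); rewrite mulr0 /padic_comb big1 // => i _.
  by rewrite rmorph0 mul0r.
have [j [k [a [pa xa]]]] := padic_normal_form x0.
have Sa0 : S a != 0.
  apply: contra_neq (mulf_neq0 (iota_p_neq0 k) x0) => Sa0.
  by rewrite xa Sa0 mulr0.
have vx : k%:R + v x = j%:R + v (S a).
  by rewrite -!val_pX -!vM ?iota_p_neq0 // xa.
have ltC : v (S a) < C%:R.
  by rewrite ltNge; apply/negP => le; apply: (CP a pa); rewrite /vge le orbT.
have le_k : (k <= j + C)%N.
  rewrite -(ler_nat rat) natrD; move: xO; rewrite /vge (negPf x0) /= => xO.
  move: ltC vx xO; lra.
exists (fun i => p%:R ^+ (j + C - k) * a i); rewrite padic_combZ.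
apply: (mulfI (iota_p_neq0 k)); rewrite mulrCA xa !mulrA -!rmorphM -!exprD.
by rewrite subnKC // addnC.
Qed.

(** Integral elements are classified by the coordinates of p^C x modulo p^D, with D large enough to
    offset both the factor p^C and the lower bound on the valuations of combinations. *)
Lemma padic_finite_quotient : exists (T : finType) (c : L -> T),
  forall x y, vge v 0 x -> vge v 0 y -> c x = c y -> vge v 1 (x - y).
Proof.
have [C CP] := padic_lattice_bound; have [c cP] := padic_comb_bounded_below.
have /archi_boundP := normr_ge0 (C%:R + 1 - c).
set D := Num.bound _ => ltD.
have /choice[a aP] x : exists a, vge v 0 x -> iota (p%:R ^+ C) * x = S a.
  have [/CP[a aP]|] := boolP (vge v 0 x); first by exists a.
  by exists (fun=> 0).
have lta x i : (`|a x i D| < p ^ D)%N.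
  have /andP[a0 alt] := padic_digit_bounds (a x i) D.
  by rewrite -ltz_nat gez0_abs.
exists {ffun I -> 'I_(p ^ D)}, (fun x => [ffun i => Ordinal (lta x i)]).
move=> x y xO yO /ffunP xy.
have /choice[b bP] i : exists b, a x i - a y i = p%:R ^+ D * b.
  apply: padic_dvd; rewrite padic_digitD padic_digitN modzDmr.
  have /andP[ax _] := padic_digit_bounds (a x i) D.
  have /andP[ay _] := padic_digit_bounds (a y i) D.
  have := xy i; rewrite !ffunE => /(congr1 val) /= /(congr1 Posz).
  by rewrite !gez0_abs // => ->; rewrite subrr mod0z.
have : vge v (D%:R + c) (iota (p%:R ^+ C) * (x - y)).
  rewrite mulrBr !aP // -padic_combB.
  rewrite (_ : (fun i => _) = (fun i => p%:R ^+ D * b i)); last exact: funext.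
  by rewrite padic_combZ; apply: vgeM => //; rewrite /vge val_pX lexx orbT.
rewrite /vge mulf_eq0 (negPf (iota_p_neq0 _)) /=.
have [//|xy0] /= := eqVneq (x - y) 0; rewrite vM ?iota_p_neq0 // val_pX => le.
have := ler_norm (C%:R + 1 - c); move: ltD le; lra.
Qed.
End OneValuation.

Lemma extension_unique (v w : L -> rat) :
    (forall x y, x != 0 -> y != 0 -> v (x * y) = v x + v y) ->
    (forall x y, x != 0 -> y != 0 -> x + y != 0 ->
       Num.min (v x) (v y) <= v (x + y)) ->
    (forall x y, x != 0 -> y != 0 -> w (x * y) = w x + w y) ->
    (forall x y, x != 0 -> y != 0 -> x + y != 0 ->
       Num.min (w x) (w y) <= w (x + y)) ->
    (forall (x : Zp) n, x n = 0 -> x n.+1 != 0 -> v (iota x) = n%:R) ->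
    (forall (x : Zp) n, x n = 0 -> x n.+1 != 0 -> w (iota x) = n%:R) ->
    (forall x, exists d a, d != 0 /\ iota d * x = S a) ->
  forall x, x != 0 -> v x <= w x.
Proof.
move=> vM vD wM wD v_iota w_iota span_e.
have [C CP] := padic_comb_bounded_above vM vD v_iota.
have [c cP] := padic_comb_bounded_below wM wD w_iota.
have bound x : x != 0 -> v x <= w x + (C%:R - c).
  move=> x0; have [j [k [a [pa xa]]]] := padic_normal_form span_e x0.
  have pk n := iota_p_neq0 v_iota n.
  have Sa0 : S a != 0.
    by apply: contra_neq (mulf_neq0 (pk k) x0) => Sa0; rewrite xa Sa0 mulr0.
  have vx : k%:R + v x = j%:R + v (S a).
    by rewrite -!(val_pX vM v_iota) -!vM ?pk // xa.
  have wx : k%:R + w x = j%:R + w (S a).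
    by rewrite -!(val_pX wM w_iota) -!wM ?pk // xa.
  have ltC : v (S a) < C%:R.
    by rewrite ltNge; apply/negP => le; apply: (CP a pa); rewrite /vge le orbT.
  have := cP a; rewrite /vge (negPf Sa0) /= => lec.
  by move: vx wx ltC lec; lra.
(* The bound at [x ^+ n] reads n (v x - w x) <= C - c, which fails for large n if v x > w x. *)
move=> x x0; rewrite leNgt; apply/negP => lt.
have /archi_boundP := normr_ge0 ((C%:R - c) / (v x - w x)).
set n := Num.bound _ => ltn.
have := bound _ (expf_neq0 n x0); rewrite (valuationX vM) // (valuationX wM) //.
rewrite -[v x *+ n]mulr_natl -[w x *+ n]mulr_natl => le.
have vw : 0 < v x - w x by rewrite subr_gt0.
have := le_lt_trans (ler_norm _) ltn; rewrite ltr_pdivrMr //.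
by move: le; lra.
Qed.
End NormEquivalence.

(** * The residue field and its Galois action *)

Section ResidueField.
Variables (L : fieldType) (v : L -> rat).
Hypothesis vM : forall x y, x != 0 -> y != 0 -> v (x * y) = v x + v y.
Hypothesis vD : forall x y, x != 0 -> y != 0 -> x + y != 0 ->
  Num.min (v x) (v y) <= v (x + y).
Local Notation O x := (vge v 0 x).

(** The maximal ideal of the valuation ring. *)
Definition vpos x := (x == 0) || (0 < v x).

Lemma vposP x : reflect (exists2 r, 0 < r & vge v r x) (vpos x).
Proof.
apply: (iffP orP) => [[/eqP->|x0]|[r r0 /orP[->|rx]]].
- by exists 1 => //; apply: vge0.
- by exists (v x); rewrite // /vge lexx orbT.
- by left.
by right; apply: lt_le_trans rx.
Qed.

Lemma vpos0 : vpos 0. Proof. by rewrite /vpos eqxx. Qed.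

Lemma vposD x y : vpos x -> vpos y -> vpos (x + y).
Proof.
move=> /vposP[r r0 rx] /vposP[s s0 sy]; apply/vposP; exists (Num.min r s).
  by rewrite lt_min r0.
by apply: vgeD => //; [apply: vge_le rx|apply: vge_le sy];
   rewrite ge_min lexx ?orbT.
Qed.

Lemma vposN x : vpos (- x) = vpos x.
Proof. by rewrite /vpos oppr_eq0 (valuationN vM). Qed.

Lemma vposM x y : O x -> vpos y -> vpos (x * y).
Proof.
move=> x0 /vposP[s s0 sy]; apply/vposP; exists s => //.
by rewrite -[s]add0r; apply: vgeM.
Qed.

Lemma vpos_vge x : vpos x -> O x.
Proof. by case/vposP=> r r0; apply: vge_le; apply: ltW. Qed.

Lemma vge_unit x : O x -> ~~ vpos x -> x != 0 /\ O x^-1.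
Proof.
rewrite /vpos /vge negb_or => /orP[->//|vx] /andP[x0]; rewrite -leNgt => vx0.
split=> //; rewrite (valuationV vM) // oppr_ge0 vx0; exact: orbT.
Qed.

(** Residue classes are encoded by the value of c at a chosen representative, so the carrier is a
    subtype of T and therefore finite. The field laws are checked on lifts. *)
Lemma residue_field (T : finType) (c : L -> T) :
    (forall x y, O x -> O y -> c x = c y -> vpos (x - y)) ->
  exists (l : finFieldType) (rho : L -> l),
    [/\ rho 1 = 1,
        forall x y, O x -> O y -> rho (x + y) = rho x + rho y,
        forall x y, O x -> O y -> rho (x * y) = rho x * rho y,
        forall x, O x -> (rho x == 0) = vpos x &
        forall t, exists2 x, O x & rho x = t].
Proof.
move=> cP; pose eqv x y := O y && vpos (x - y).
pose rep x := choose (eqv x) x.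
have vposxx x : vpos (x - x) by rewrite subrr vpos0.
have vpos_sym x y : vpos (x - y) = vpos (y - x) by rewrite -vposN opprB.
have vpos_trans x y z : vpos (x - y) -> vpos (y - z) -> vpos (x - z).
  by move=> xy yz; rewrite -(subrK y x) -addrA; apply: vposD.
have repP x : O x -> O (rep x) /\ vpos (x - rep x).
  move=> xO; have /chooseP/andP : eqv x x by rewrite /eqv xO vposxx.
  by [].
have rep_eq x y : O x -> O y -> vpos (x - y) -> rep x = rep y.
  move=> xO yO xy; rewrite /rep (@eq_choose _ (eqv x) (eqv y)) => [|z].
    apply: choose_id; rewrite /eqv ?xO ?yO ?vposxx //.
    by rewrite vpos_sym.
  rewrite /eqv; case: (O z) => //=; apply/idP/idP => [|]; apply: vpos_trans.
    by rewrite vpos_sym.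
  by [].
pose R0 := {t : T | `[< exists2 x, O x & c (rep x) = t >]}.
have R0P x : O x -> `[< exists2 y, O y & c (rep y) = c (rep x) >].
  by move=> xO; apply/asboolP; exists x.
pose r0 : R0 := exist _ (c (rep 1)) (R0P 1 (vge1 vM)).
(* On the valuation ring the default [r0] is never taken, by [R0P]. *)
pose rho x : R0 := insubd r0 (c (rep x)).
have rho_eq x y : O x -> O y -> rho x = rho y <-> vpos (x - y).
  move=> xO yO; split=> [/(congr1 val)|xy]; last by rewrite /rho (rep_eq x y).
  rewrite !val_insubd !R0P // => rxy.
  have [[rx xr] [ry yr]] := (repP x xO, repP y yO).
  apply: vpos_trans xr (vpos_trans _ _ _ (cP _ _ rx ry rxy) _).
  by rewrite vpos_sym.
have /choice[s sP] (t : R0) : exists x, O x /\ rho x = t.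
  have /asboolP[x xO xt] := valP t; exists x; split=> //.
  by apply: val_inj; rewrite val_insubd R0P.
have sO t : O (s t) by case: (sP t).
have sK t : rho (s t) = t by case: (sP t).
have rhoK x : O x -> vpos (x - s (rho x)).
  by move=> xO; apply/rho_eq; rewrite ?sK.
pose add (t u : R0) := rho (s t + s u).
pose mul (t u : R0) := rho (s t * s u).
pose opp (t : R0) := rho (- s t).
have OD := vgeD vD (r := 0); have OM := vgeM0 vM.
have ON x : O x -> O (- x) by rewrite (vgeN vM).
have rhoD x y : O x -> O y -> rho (x + y) = add (rho x) (rho y).
  move=> xO yO; apply/rho_eq; rewrite ?OD //.
  by rewrite opprD addrACA; apply: vposD; apply: rhoK.
have rhoM x y : O x -> O y -> rho (x * y) = mul (rho x) (rho y).
  move=> xO yO; apply/rho_eq; rewrite ?OM //.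
  rewrite -(subrK (x * s (rho y)) (x * y)) -mulrBr -addrA -mulrBl.
  by apply: vposD; [|rewrite mulrC]; apply: vposM => //; apply: rhoK.
have rhoN x : O x -> rho (- x) = opp (rho x).
  move=> xO; apply/rho_eq; rewrite ?ON //.
  by rewrite -opprD vposN; apply: rhoK.
have O0 := vge0 v 0; have O1 := vge1 vM.
have addA : associative add.
  by move=> t u w; rewrite -(sK t) -(sK u) -(sK w) -!rhoD ?OD // addrA.
have addC : commutative add.
  by move=> t u; rewrite -(sK t) -(sK u) -!rhoD ?OD // addrC.
have add0 : left_id (rho 0) add.
  by move=> t; rewrite -(sK t) -!rhoD ?OD // add0r.
have addN : left_inverse (rho 0) opp add.
  by move=> t; rewrite -(sK t) -rhoN // -!rhoD ?ON // addNr.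
have mulA : associative mul.
  by move=> t u w; rewrite -(sK t) -(sK u) -(sK w) -!rhoM ?OM // mulrA.
have mulC : commutative mul.
  by move=> t u; rewrite -(sK t) -(sK u) -!rhoM ?OM // mulrC.
have mul1 : left_id (rho 1) mul.
  by move=> t; rewrite -(sK t) -!rhoM ?OM // mul1r.
have mulDl : left_distributive mul add.
  move=> t u w; rewrite -(sK t) -(sK u) -(sK w).
  by rewrite -!(rhoM, rhoD) ?OM ?OD // mulrDl.
have rho0 x : O x -> rho x = rho 0 <-> vpos x.
  by move=> xO; rewrite -[x in vpos x]subr0; apply: rho_eq.
have one0 : rho 1 != rho 0.
  by apply/eqP => /(rho0 1 O1); rewrite /vpos oner_eq0 (valuation1 vM) ltxx.
pose inv (t : R0) := if t == rho 0 then rho 0 else rho (s t)^-1.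
have mulV (t : R0) : t != rho 0 -> mul (inv t) t = rho 1.
  move=> t0; rewrite /inv (negPf t0).
  have [st0 sVO] : s t != 0 /\ O (s t)^-1.
    apply: vge_unit => //; apply: contra t0 => /(rho0 _ (sO t)).
    by rewrite sK => ->.
  by rewrite -[X in mul _ X]sK -rhoM // mulVf.
have inv0 : inv (rho 0) = rho 0 by rewrite /inv eqxx.
pose zm := GRing.isZmodule.Build R0 addA addC add0 addN.
pose R1 : zmodType := HB.pack R0 zm.
pose rm := GRing.Zmodule_isComNzRing.Build R1 mulA mulC mul1 mulDl one0.
pose R2 : comNzRingType := HB.pack R1 rm.
pose fm := GRing.ComNzRing_isField.Build R2 mulV inv0.
pose R3 : finFieldType := HB.pack R0 zm rm fm.
exists R3, rho; split=> //.
  by move=> x xO; apply/eqP/idP => /(rho0 x xO).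
by move=> t; exists (s t).
Qed.
End ResidueField.

(** * The Galois action on the residue field *)

Section UnramifiedGalois.
Variables (L : fieldType) (v : L -> rat).
Hypothesis vM : forall x y, x != 0 -> y != 0 -> v (x * y) = v x + v y.
Hypothesis vD : forall x y, x != 0 -> y != 0 -> x + y != 0 ->
  Num.min (v x) (v y) <= v (x + y).
Local Notation O x := (vge v 0 x).
Local Notation vpos := (vpos v).

(** Discreteness for a rational-valued v: an element of the maximal ideal differs from a fixed
    element of its class by something of valuation at least 1, and there are finitely many classes
    over which to take a minimum. *)
Lemma finite_quotient_gap (T : finType) (c : L -> T) :
    (forall x y, O x -> O y -> c x = c y -> vge v 1 (x - y)) ->
  exists2 eps, 0 < eps & forall x, vpos x -> vge v eps x.
Proof.
move=> cP; have /choice[e eP] (t : T) : exists r, 0 < r /\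
    forall x, vpos x -> c x = t -> vge v r x.
  have [[x0 [x0P x0t]]|no] := pselect (exists x0, vpos x0 /\ c x0 = t); last first.
    by exists 1; split=> // x xP xt; case: no; exists x.
  have /vposP[r r0 rx0] := x0P; exists (Num.min 1 r); split=> [|x xP xt].
    by rewrite lt_min r0 ltr01.
  rewrite -(subrK x0 x); apply: vgeD => //.
    apply: vge_le (cP x x0 _ _ _); rewrite ?xt ?x0t ?ge_min ?lexx //;
      exact: vpos_vge.
  by apply: vge_le rx0; rewrite ge_min lexx orbT.
exists (\big[Num.min/1]_t e t) => [|x xP].
  apply: (big_ind (fun r => 0 < r)) => // [r s r0 s0|t _]; last by case: (eP t).
  by rewrite lt_min r0.
have [_ /(_ x xP erefl)] := eP (c x).
by apply: vge_le; apply: bigmin_le_cond.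
Qed.

Variables (gT : finGroupType) (sigma : gT -> {rmorphism L -> L}).
Hypothesis sigma1 : forall x, sigma 1%g x = x.
Hypothesis sigmaM : forall g h x, sigma (g * h)%g x = sigma h (sigma g x).
Hypothesis sigma_faithful : forall g, sigma g =1 id -> g = 1%g.
Hypothesis v_sigma : forall g x, x != 0 -> v (sigma g x) = v x.
Hypothesis v_fixed : forall x, x != 0 ->
  exists2 y, y != 0 & (forall g, sigma g y = y) /\ v y = v x.

Lemma vge_sigma r g x : vge v r (sigma g x) = vge v r x.
Proof. by rewrite /vge fmorph_eq0; have [//|x0] := eqVneq x 0; rewrite v_sigma. Qed.

Variables (l : finFieldType) (rho : L -> l).
Hypothesis rho1 : rho 1 = 1.
Hypothesis rhoD : forall x y, O x -> O y -> rho (x + y) = rho x + rho y.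
Hypothesis rhoM : forall x y, O x -> O y -> rho (x * y) = rho x * rho y.
Hypothesis rho_eq0 : forall x, O x -> (rho x == 0) = vpos x.
Hypothesis rho_onto : forall t, exists2 x, O x & rho x = t.

Lemma rho0 : rho 0 = 0.
Proof. by apply/eqP; rewrite rho_eq0 ?vpos0 // vge0. Qed.

Lemma rhoN x : O x -> rho (- x) = - rho x.
Proof.
move=> xO; apply/eqP; rewrite -addr_eq0 -rhoD ?(vgeN vM) //.
by rewrite addNr rho0.
Qed.

Lemma rhoB x y : O x -> O y -> rho (x - y) = rho x - rho y.
Proof. by move=> xO yO; rewrite rhoD ?(vgeN vM) // rhoN. Qed.

Lemma rho_sum (I : Type) (s : seq I) (P : pred I) (F : I -> L) :
  (forall i, P i -> O (F i)) ->
  rho (\sum_(i <- s | P i) F i) = \sum_(i <- s | P i) rho (F i).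
Proof.
move=> FO; suff [] : O (\sum_(i <- s | P i) F i) /\
  rho (\sum_(i <- s | P i) F i) = \sum_(i <- s | P i) rho (F i) by [].
apply: (big_rec2 (fun x y => O x /\ rho x = y)); first by rewrite vge0 rho0.
move=> i y x Pi [xO <-]; rewrite rhoD ?FO //; split=> //.
by apply: vgeD; rewrite ?FO.
Qed.

Lemma rho_prod (I : Type) (s : seq I) (P : pred I) (F : I -> L) :
  (forall i, P i -> O (F i)) ->
  rho (\prod_(i <- s | P i) F i) = \prod_(i <- s | P i) rho (F i).
Proof.
move=> FO; suff [] : O (\prod_(i <- s | P i) F i) /\
  rho (\prod_(i <- s | P i) F i) = \prod_(i <- s | P i) rho (F i) by [].
apply: (big_rec2 (fun x y => O x /\ rho x = y)); first by rewrite (vge1 vM) rho1.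
move=> i y x Pi [xO <-]; rewrite rhoM ?FO //; split=> //.
by apply: vgeM0; rewrite ?FO.
Qed.

Lemma rho_eq x y : O x -> O y -> (rho x == rho y) = vpos (x - y).
Proof. by move=> xO yO; rewrite -subr_eq0 -rhoB // rho_eq0 // (vgeB vM). Qed.

Lemma vge_nat n : O n%:R.
Proof.
elim: n => [|n IHn]; rewrite ?vge0 // mulrSr.
by apply: vgeD => //; apply: vge1.
Qed.

Lemma rho_nat n : rho n%:R = n%:R.
Proof.
elim: n => [|n IHn]; first exact: rho0.
by rewrite !mulrSr rhoD ?vge_nat ?(vge1 vM) // IHn rho1.
Qed.

Lemma residue_action : exists s : gT -> {rmorphism l -> l},
  forall g x, O x -> s g (rho x) = rho (sigma g x).
Proof.
suff /choice[s sP] g : exists f : {rmorphism l -> l},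
  forall x, O x -> f (rho x) = rho (sigma g x) by exists s.
have /choice[s sP] (t : l) : exists x, O x /\ rho x = t.
  by have [x] := rho_onto t; exists x.
pose f t := rho (sigma g (s t)).
have fE x : O x -> f (rho x) = rho (sigma g x).
  move=> xO; have [sO sK] := sP (rho x).
  apply/eqP; rewrite rho_eq ?vge_sigma // -rmorphB.
  have : vpos (s (rho x) - x) by rewrite -rho_eq // sK.
  rewrite /vpos fmorph_eq0; have [//|d0] := eqVneq (s (rho x) - x) 0.
  by rewrite v_sigma.
have sO t : O (s t) by case: (sP t).
have sK t : rho (s t) = t by case: (sP t).
have fB : zmod_morphism f.
  move=> t u; rewrite -(sK t) -(sK u) -rhoB // !fE ?(vgeB vM) //.
  by rewrite rmorphB rhoB ?vge_sigma.
have fM : monoid_morphism f.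
  split=> [|t u]; first by rewrite -rho1 fE ?(vge1 vM) // rmorph1.
  rewrite -(sK t) -(sK u) -rhoM // !fE ?(vgeM0 vM) //.
  by rewrite rmorphM rhoM ?vge_sigma.
pose fa := GRing.isZmodMorphism.Build l l f fB.
pose fm := GRing.isMonoidMorphism.Build l l f fM.
pose F : {rmorphism l -> l} := HB.pack f fa fm.
by exists F.
Qed.

Variable s : gT -> {rmorphism l -> l}.
Hypothesis s_rho : forall g x, O x -> s g (rho x) = rho (sigma g x).

Lemma residue_action1 t : s 1%g t = t.
Proof. by have [x xO <-] := rho_onto t; rewrite s_rho // sigma1. Qed.

Lemma residue_actionM g h t : s (g * h)%g t = s h (s g t).
Proof.
by have [x xO <-] := rho_onto t; rewrite !s_rho ?vge_sigma // sigmaM.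
Qed.

Variable eps : rat.
Hypothesis eps_gt0 : 0 < eps.
Hypothesis vpos_eps : forall x, vpos x -> vge v eps x.

Lemma vge_eps_eq0 x : (forall k : nat, vge v (k%:R * eps) x) -> x = 0.
Proof.
move=> kx; apply/eqP; apply: contraT => x0.
have /archi_boundP := normr_ge0 (v x / eps); set n := Num.bound _ => ltn.
have := le_lt_trans (ler_norm _) ltn; rewrite ltr_pdivrMr // ltNge.
by have := kx n; rewrite /vge (negPf x0) /= => ->.
Qed.

(* Averaged trace of x if #[h] is prime to the residue characteristic, otherwise
   the norm of a #[h]-th root of x modulo the maximal ideal. *)
Lemma inert_prime_fixed_rep h : prime #[h]%g -> s h =1 id ->
  forall x, O x -> exists y, [/\ O y, sigma h y = y & vpos (x - y)].
Proof.
move=> pr_h sh x xO; set q := #[h]%g in pr_h.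
have sH k : k \in <[h]>%g -> s k =1 id.
  case/cycleP=> i -> t; elim: i => [|i IHi].
    by rewrite expg0 residue_action1.
  by rewrite expgSr residue_actionM IHi sh.
have rhoH k z : k \in <[h]>%g -> O z -> rho (sigma k z) = rho z.
  by move=> kH zO; rewrite -s_rho // sH.
have [q0|q0] := eqVneq (q%:R : l) 0.
  have charl : q \in [pchar l] by rewrite inE pr_h q0 /=.
  (* Frobenius is bijective on the finite field l; z lifts the q-th root of the residue of x. *)
  have [F' _ F'K] := injF_bij (fmorph_inj (pFrobenius_aut charl)).
  have [z zO zt] := rho_onto (F' (rho x)).
  exists (\prod_(k in <[h]>%g) sigma k z).
  have zkO k : O (sigma k z) by rewrite vge_sigma.
  split.
  - by apply: vge_prod.
  - rewrite rmorph_prod [RHS](reindex_inj (mulIg h)).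
    by apply: eq_big => [k|k _]; rewrite ?groupMr ?cycle_id // sigmaM.
  rewrite -rho_eq //; last exact: vge_prod.
  rewrite rho_prod // (eq_bigr (fun=> rho z)); last by move=> k kH; apply: rhoH.
  by rewrite prodr_const -/q zt -[F' _ ^+ _]/(pFrobenius_aut charl _) F'K.
have qO := vge_nat q; have [qL0 qVO] : q%:R != 0 :> L /\ O q%:R^-1.
  by apply: vge_unit => //; rewrite -rho_eq0 // rho_nat.
exists (q%:R^-1 * \sum_(k in <[h]>%g) sigma k x).
have xkO k : O (sigma k x) by rewrite vge_sigma.
have sumO : O (\sum_(k in <[h]>%g) sigma k x) by apply: vge_sum.
split; first exact: vgeM0.
  rewrite rmorphM fmorphV rmorph_nat rmorph_sum; congr (_ * _).
  rewrite [RHS](reindex_inj (mulIg h)).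
  by apply: eq_big => [k|k _]; rewrite ?groupMr ?cycle_id // sigmaM.
rewrite -rho_eq //; last exact: vgeM0.
apply/eqP/(mulfI q0); rewrite -{2}rho_nat -rhoM //; last exact: vgeM0.
rewrite mulVKf // rho_sum // (eq_bigr (fun=> rho x)).
  by rewrite sumr_const -/q mulr_natl.
by move=> k kH; apply: rhoH.
Qed.

Lemma residue_action_faithful g : s g =1 id -> g = 1%g.
Proof.
move=> sg; apply/eqP; apply: contraT; rewrite -order_gt1 => og.
have q_pr := pdiv_prime og; set q := pdiv _ in q_pr.
pose h := (g ^+ (#[g] %/ q))%g.
have oh : #[h]%g = q.
  rewrite orderXdiv ?dvdn_div ?pdiv_dvd // divnA ?pdiv_dvd //.
  by rewrite mulKn // (ltnW og).
have sh : s h =1 id.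
  rewrite /h => t; elim: (_ %/ _)%N => [|i IHi].
    by rewrite expg0 residue_action1.
  by rewrite expgSr residue_actionM IHi sg.
have pr_h : prime #[h]%g by rewrite oh.
(* Each round gains [eps]: x - y = w z with y fixed by h, w fixed of the same valuation as x - y,
   and z integral, so h x - x = w (h z - z). *)
have fixO x : O x -> sigma h x = x.
  move=> xO; apply/eqP; rewrite -subr_eq0; apply/eqP/vge_eps_eq0 => k.
  elim: k x xO => [|k IHk] x xO.
    by rewrite mul0r (vgeB vM) ?vge_sigma.
  have [y [yO hy xy]] := inert_prime_fixed_rep pr_h sh xO.
  have [/eqP|d0] := eqVneq (x - y) 0.
    by rewrite subr_eq0 => /eqP->; rewrite hy subrr vge0.
  have [w w0 [wfix vw]] := v_fixed d0.
  pose z := w^-1 * (x - y).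
  have zO : O z.
    by rewrite /vge vM ?invr_eq0 // (valuationV vM) // vw addNr lexx orbT.
  have -> : sigma h x - x = w * (sigma h z - z).
    rewrite mulrBr -{1}(wfix h) -rmorphM mulVKf // rmorphB hy.
    by rewrite opprB addrA subrK.
  rewrite -natr1 mulrDl mul1r addrC; apply: vgeM => //; last exact: IHk.
  by have := vpos_eps xy; rewrite /vge (negPf d0) (negPf w0) vw.
have h1 : h = 1%g.
  (* An element outside the valuation ring has its inverse inside. *)
  apply: sigma_faithful => x /=; have [/fixO //|] := boolP (O x).
  rewrite /vge negb_or -ltNge => /andP[x0 vx].
  apply: (can_inj (@invrK L)); rewrite -fmorphV fixO //.
  by rewrite /vge invr_eq0 (negPf x0) (valuationV vM) // oppr_ge0 ltW.
by move: pr_h; rewrite h1 order1.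
Qed.


(** * Integrality of coefficients and an integral generator *)

Section HopfOrder.
Variable N : {group {perm gT}}.
Hypothesis cardN : #|N| = #|[set: gT]|.
Hypothesis transN : [transitive N, on [set: gT] | 'P].
Hypothesis normN : forall g, left_translation g \in 'N(N)%g.

Lemma min_valuation_coef (b : {perm gT} -> L) n1 : n1 \in N -> b n1 != 0 ->
  exists n0, [/\ n0 \in N, b n0 != 0, v (b n0) <= v (b n1) &
                 forall n, n \in N -> O (b n / b n0)].
Proof.
move=> n1N b1; pose P n := (n \in N) && (b n != 0).
have P1 : P n1 by rewrite /P n1N.
case: (arg_minP (fun n => v (b n)) P1) => n0 /andP[n0N b0] min.
exists n0; split=> // [|n nN]; first exact: min.
rewrite /vge mulf_eq0 invr_eq0 (negPf b0) orbF.
have [//|bn] /= := eqVneq (b n) 0.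
by rewrite vM ?invr_eq0 // (valuationV vM) // subr_ge0 min // /P nN.
Qed.

Lemma vge_div_vpos a x : a != 0 -> v a < 0 -> O x -> vpos (a^-1 * x).
Proof.
move=> a0 va; rewrite /vpos /vge mulf_eq0 invr_eq0 (negPf a0) /=.
have [//|x0] /= := eqVneq x 0 => vx.
by rewrite vM ?invr_eq0 // (valuationV vM) //; lra.
Qed.

Lemma coef_integral (b : {perm gT} -> L) :
    (forall x, O x -> O (\sum_(n in N) b n * sigma (n^-1 1)%g x)) ->
  forall n, n \in N -> O (b n).
Proof.
move=> bO n1 n1N; apply: contraT; rewrite {1}/vge negb_or -ltNge => /andP[b1 vb1].
have [n0 [n0N b0 le01 dO]] := min_valuation_coef n1N b1.
have vb0 := le_lt_trans le01 vb1.
(* By regularity n |-> n^-1(1) is a bijection from N to G, so the reduced relation involves each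
   automorphism once, with coefficient 1 at n0^-1(1). *)
pose nu := regular_elt N; pose c g := rho (b (nu g)^-1%g / b n0).
have nuN g : (nu g)^-1%g \in N by rewrite groupV; case: (regular_eltP transN g).
have c0 t : \sum_g c g * s g t = 0.
  have [x xO <-] := rho_onto t.
  apply/eqP; rewrite (_ : \sum_g _ = rho ((b n0)^-1 *
      \sum_(n in N) b n * sigma (n^-1 1)%g x)).
    have P := vge_div_vpos b0 vb0 (bO x xO).
    by rewrite rho_eq0 //; apply: vpos_vge.
  rewrite mulr_sumr rho_sum => [|n nN]; last first.
    by rewrite mulrA (mulrC _ (b n)) vgeM0 ?dO ?vge_sigma.
  rewrite (reindex_onto (fun g => (nu g)^-1%g) (fun n => (n^-1 1)%g)) /=; last first.
    by move=> n nN; rewrite /nu (regular_eltK cardN) ?groupV // invgK.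
  apply: eq_big => [g|g _].
    by rewrite nuN invgK; case: (regular_eltP transN g) => _ ->; rewrite eqxx.
  rewrite invgK; case: (regular_eltP transN g) => _ ->.
  by rewrite mulrA (mulrC _ (b _)) rhoM ?dO ?vge_sigma // s_rho.
have := dedekind_independence residue_action1 residue_actionM
  residue_action_faithful c0.
move/(_ (n0^-1 1)%g); rewrite /c /nu (regular_eltK cardN transN) ?groupV // invgK.
by rewrite divff // rho1 => /eqP; rewrite oner_eq0.
Qed.

(** Injectivity modulo the maximal ideal, for any lift m of a generator over the residue field: the
    reduction of b annihilates that generator. *)
Lemma orbit_sum_regular : exists2 m, O m & forall b : {perm gT} -> L,
    (forall n, n \in N -> O (b n)) ->
    (forall x, vpos (\sum_(n in N) b n * sigma (n^-1 x)%g m)) ->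
  forall n, n \in N -> vpos (b n).
Proof.
have [mu muP] := finField_hopf_normal_basis cardN transN normN
  residue_action1 residue_actionM residue_action_faithful.
have [m mO mE] := rho_onto mu; exists m => // b bO bm n nN.
rewrite -rho_eq0 ?bO //.
pose bbar : {ffun {perm gT} -> l} := [ffun n => if n \in N then rho (b n) else 0].
suff /ffunP/(_ n) : bbar = 0 by rewrite !ffunE nN => ->.
apply: muP => [k /negPf kN|x]; first by rewrite ffunE kN.
transitivity (rho (\sum_(n in N) b n * sigma (n^-1 x)%g m)); last first.
  by apply/eqP; rewrite rho_eq0 //; apply: vpos_vge.
rewrite rho_sum => [|k kN]; last by rewrite vgeM0 ?bO ?vge_sigma.
by apply: eq_bigr => k kN; rewrite ffunE kN -mE s_rho // rhoM ?bO ?vge_sigma.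
Qed.

Local Notation LN := {ffun {perm gT} -> L}.
Local Notation act := (perm_act N).
Local Notation orb := (orbit_fun sigma).

(** In both halves b is divided by a coefficient of least valuation. That coefficient becomes 1
    while the combinations fall into the maximal ideal, against [orbit_sum_regular]. *)
Lemma integral_generator : exists2 m, O m &
  (forall b : LN, (forall n, n \notin N -> b n = 0) ->
     (forall x, O (act b (orb m) x)) -> forall n, O (b n)) /\
  (forall b : LN, (forall n, n \notin N -> b n = 0) -> act b (orb m) = 0 -> b = 0).
Proof.
have [m mO mP] := orbit_sum_regular; exists m => //.
have key (b : LN) n1 : n1 \in N -> b n1 != 0 ->
    (forall a x, v a <= v (b n1) -> a != 0 -> vpos (a^-1 * act b (orb m) x)) ->
  False.
  move=> n1N b1 bm; have [n0 [n0N b0 le01 dO]] := min_valuation_coef n1N b1.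
  have /(_ _ n0 n0N) := mP _ dO; rewrite divff // => vpos1.
  suff : vpos 1 by rewrite /vpos oner_eq0 (valuation1 vM) ltxx.
  apply: vpos1 => x; have := bm _ x le01 b0; rewrite ffunE mulr_sumr.
  by under eq_bigr do rewrite ffunE mulrA (mulrC _ (b _)).
split=> b bN bm.
  move=> n1; have [n1N|/bN->] := boolP (n1 \in N); last exact: vge0.
  apply: contraT; rewrite {1}/vge negb_or -ltNge => /andP[b1 vb1].
  exfalso; apply: (key b n1) => // a x va a0; apply: vge_div_vpos => //.
  exact: le_lt_trans va vb1.
apply/ffunP => n1; rewrite ffunE; have [n1N|/bN //] := boolP (n1 \in N).
apply/eqP; apply: contraT => b1; exfalso; apply: (key b n1) => // a x _ _.
by rewrite bm ffunE mulr0 vpos0.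
Qed.

(** Injectivity makes the square matrix [M] of the system invertible over L. The solution is
    integral by the first property of m, and fixed by G because its conjugates solve the same
    system. *)
Lemma integral_generator_onto m : O m ->
    (forall b : LN, (forall n, n \notin N -> b n = 0) ->
       (forall x, O (act b (orb m) x)) -> forall n, O (b n)) ->
    (forall b : LN, (forall n, n \notin N -> b n = 0) -> act b (orb m) = 0 -> b = 0) ->
  forall y, O y -> exists b : LN, [/\ forall n, n \notin N -> b n = 0,
    forall g, semilinear_act sigma (@conj_lam gT) g b = b, forall n, O (b n) &
    act b (orb m) 1%g = y].
Proof.
move=> mO m_int m_inj y yO; pose nu := regular_elt N.
have nuN g : nu g \in N by case: (regular_eltP transN g).
have nu1 g : nu g 1%g = g by case: (regular_eltP transN g).
pose M := \matrix_(i < #|gT|, j < #|gT|)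
  sigma ((nu (enum_val i))^-1 (enum_val j))%g m.
pose vec (u : 'rV[L]_#|gT|) : LN :=
  [ffun n : {perm gT} => if n \in N then u 0 (enum_rank (n 1%g)) else 0].
have vecN u n : n \notin N -> vec u n = 0 by rewrite ffunE => /negPf->.
have vecM u x : act (vec u) (orb m) x = (u *m M) 0 (enum_rank x).
  rewrite ffunE mxE (reindex_onto (fun i => nu (enum_val i))
    (fun n : {perm gT} => enum_rank (n 1%g))) /=; last first.
    by move=> n nN; rewrite enum_rankK /nu (regular_eltK cardN).
  apply: eq_big => [i|i _]; first by rewrite nuN nu1 enum_valK eqxx.
  by rewrite !ffunE nuN nu1 enum_valK !mxE enum_rankK.
have Mu : M \in unitmx.
  rewrite -row_free_unit; apply: inj_row_free => u uM.
  have u0 : vec u = 0.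
    by apply: m_inj (vecN u) _; apply/ffunP => x; rewrite vecM uM mxE ffunE.
  apply/rowP => i; rewrite mxE.
  have := congr1 (fun b : LN => b (nu (enum_val i))) u0.
  by rewrite !ffunE nuN nu1 enum_valK.
pose b := vec ((\row_j sigma (enum_val j) y) *m invmx M).
have bm : act b (orb m) = orb y.
  by apply/ffunP => x; rewrite vecM mulmxKV // mxE enum_rankK ffunE.
have bN : forall n, n \notin N -> b n = 0 by apply: vecN.
exists b; split=> // [g||]; last by rewrite bm ffunE sigma1.
  apply/eqP; rewrite -subr_eq0; apply/eqP/m_inj => [n nN|].
    rewrite ffunE [(- b) n]ffunE (bN n nN) subr0 ffunE conj_lamV bN ?rmorph0 //.
    by rewrite -(memJ_lam normN g) conjgKV.
  rewrite perm_actB -{1}(orbit_fun_fixed sigmaM m g) -perm_act_semilinear //.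
    by rewrite bm orbit_fun_fixed // subrr.
  by move=> n x _; apply: lam_equivariant.
by apply: m_int => // x; rewrite bm ffunE vge_sigma.
Qed.
End HopfOrder.
End UnramifiedGalois.

(** * Galois extensions of p-adic fields *)

Lemma fraction_numden (R : idomainType) (q : {fraction R}) :
  exists n d : R, d != 0 /\ FracField.tofrac d * q = FracField.tofrac n.
Proof.
elim/quotW: q => r; exists (frac r).1, (frac r).2; split; first exact: denom_ratioP.
unlock FracField.tofrac; rewrite -[LHS]FracField.pi_mul.
apply/eqmodP; rewrite /= FracField.equivfE /FracField.mulf /=.
by rewrite !numden_Ratio ?mul1r ?oner_neq0 ?denom_ratioP ?mulr1.
Qed.

Section PadicExtension.
Variables (p : nat) (hp : prime p) (K : fieldExtType (padic_rat hp)).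
Variable L : fieldExtType K.
Local Notation Zp := (padic_int hp).

Definition padic_emb : {rmorphism Zp -> L} :=
  in_alg L \o (in_alg K \o @FracField.tofrac Zp).

Lemma padic_emb_inj : injective padic_emb.
Proof.
move=> x y /(@fmorph_inj _ _ (in_alg L))/(@fmorph_inj _ _ (in_alg K))/eqP.
by rewrite tofrac_eq => /eqP.
Qed.

Local Notation I := ('I_(\dim {:L}) * 'I_(\dim {:K}))%type.
Definition tower_basis (k : I) : L :=
  (vbasis {:K})`_k.2 *: (vbasis {:L})`_k.1.

Lemma padic_comb_tower (a : I -> Zp) :
  padic_comb padic_emb tower_basis a =
  \sum_i (\sum_j (FracField.tofrac (a (i, j)) : padic_rat hp) *: (vbasis {:K})`_j)
            *: (vbasis {:L})`_i.
Proof.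
under [RHS]eq_bigr => i _ do rewrite scaler_suml.
rewrite pair_bigA; apply: eq_bigr => -[i j] _ /=.
by rewrite mulr_algl scalerA mulr_algl.
Qed.

Lemma tower_basis_free (a : I -> Zp) :
  padic_comb padic_emb tower_basis a = 0 -> forall k, a k = 0.
Proof.
rewrite padic_comb_tower => comb0 [i j].
have /freeP/(_ _ comb0 i) := basis_free (vbasisP {:L}).
have /freeP freeK := basis_free (vbasisP {:K}).
by move/freeK/(_ j)/eqP; rewrite tofrac_eq0 => /eqP.
Qed.

Lemma tower_basis_span x : exists d a, d != 0 /\
  padic_emb d * x = padic_comb padic_emb tower_basis a.
Proof.
pose q (k : I) := coord (vbasis {:K}) k.2 (coord (vbasis {:L}) k.1 x).
have /choice[n nP] k := fraction_numden (q k); have /choice[d dP] := nP.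
(* The product of the denominators of all coordinates serves as common denominator. *)
exists (\prod_k d k), (fun k => n k * \prod_(k' | k' != k) d k').
split; first by apply/prodf_neq0 => k _; case: (dP k).
rewrite padic_comb_tower {1}(coord_vbasis (memvf x)) mulr_sumr.
apply: eq_bigr => i _.
rewrite {1}(coord_vbasis (memvf (coord (vbasis {:L}) i x))).
rewrite mulr_algl scalerA mulr_sumr scaler_suml scaler_suml.
apply: eq_bigr => j _.
congr (_ *: _); rewrite mulr_algl scalerA; congr (_ *: _).
rewrite (bigD1 (i, j)) //= !tofracM mulrAC.
by have [_ <-] := dP (i, j).
Qed.

End PadicExtension.

Section GaloisMorphism.
Variables (K : fieldType) (L : splittingFieldType K).
Local Notation G := (gal_of {:L}).

Definition gal_rmorphism (g : G) : {rmorphism L -> L} := (gal_repr g : 'AEnd(L)).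
Local Notation sigma := gal_rmorphism.

Lemma gal_rmorphism1 x : sigma 1%g x = x.
Proof. exact: gal_id. Qed.

Lemma gal_rmorphismM g h x : sigma (g * h)%g x = sigma h (sigma g x).
Proof. exact/galM/memvf. Qed.

Lemma gal_rmorphism_faithful g : sigma g =1 id -> g = 1%g.
Proof. by move=> g1; apply/eqP/gal_eqP => x _; rewrite gal_id; apply: g1. Qed.

Lemma gal_rmorphism_base g (y : K) : sigma g y%:A = y%:A.
Proof. by rewrite /sigma /= linearZ /= rmorph1. Qed.

End GaloisMorphism.

Section UnramifiedOrder.
Variables (p : nat) (hp : prime p) (K : fieldExtType (padic_rat hp)).
Variables (L : splittingFieldType K) (v : L -> rat).
Variable N : {group {perm gal_of {:L}}}.
Hypothesis v_ext : extends_padic_valuation v.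
Hypothesis v_unr : unramified v.
Hypothesis regN : regular N.
Hypothesis normN : normalised_by_lambda N.
Local Notation G := (gal_of {:L}).
Local Notation O x := (vge v 0 x).

Let vM : forall x y, x != 0 -> y != 0 -> v (x * y) = v x + v y.
Proof. by case: v_ext => [[]]. Qed.
Let vD : forall x y, x != 0 -> y != 0 -> x + y != 0 ->
  Num.min (v x) (v y) <= v (x + y).
Proof. by case: v_ext => [[]]. Qed.
Let cardN : #|N| = #|[set: G]|. Proof. by case: regN. Qed.
Let transN : [transitive N, on [set: G] | 'P]. Proof. by case: regN. Qed.

Local Notation sigma := (@gal_rmorphism K L).

(** Precomposing v with [sigma g] gives another extension of the p-adic valuation, so uniqueness
    applies. *)
Lemma valuation_gal_le g x : x != 0 -> v x <= v (sigma g x).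
Proof.
apply: (extension_unique (@padic_emb_inj _ hp K L) (@tower_basis_free _ hp K L)
  (w := fun x => v (sigma g x))) => //.
- by move=> y z y0 z0; rewrite rmorphM vM ?fmorph_eq0.
- by move=> y z y0 z0 yz0; rewrite rmorphD vD ?fmorph_eq0 // -rmorphD fmorph_eq0.
- by case: v_ext.
- by move=> z n z0 z1; rewrite gal_rmorphism_base; case: v_ext => _; apply.
exact: tower_basis_span.
Qed.

Lemma valuation_gal g x : x != 0 -> v (sigma g x) = v x.
Proof.
move=> x0; apply/eqP; rewrite eq_le valuation_gal_le // andbT.
have := @valuation_gal_le g^-1%g (sigma g x).
by rewrite -gal_rmorphismM mulgV gal_rmorphism1 fmorph_eq0; apply.
Qed.

(** Ramification index one enters here: elements of K, fixed by G, realise every value of v. *)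
Lemma valuation_fixed x : x != 0 ->
  exists2 y, y != 0 & (forall g, sigma g y = y) /\ v y = v x.
Proof.
move=> /v_unr[y y0 yx]; exists y%:A; first by rewrite scaler_eq0 oner_eq0 orbF.
by split=> // g; rewrite gal_rmorphism_base.
Qed.

Lemma unramified_perm_module :
  (forall b : {perm G} -> L,
     (forall x, O x -> O (\sum_(n in N) b n * sigma (n^-1 1)%g x)) ->
     forall n, n \in N -> O (b n)) /\
  exists2 m, O m &
    (forall b : {ffun {perm G} -> L}, (forall n, n \notin N -> b n = 0) ->
       perm_act N b (orbit_fun sigma m) = 0 -> b = 0) /\
    forall y, O y -> exists b : {ffun {perm G} -> L},
      [/\ forall n, n \notin N -> b n = 0,
          forall g, semilinear_act sigma (@conj_lam G) g b = b,
          forall n, O (b n) & perm_act N b (orbit_fun sigma m) 1%g = y].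
Proof.
have [T [c cP]] := padic_finite_quotient (@padic_emb_inj _ hp K L)
  (@tower_basis_free _ hp K L) vM vD (proj2 v_ext) (@tower_basis_span _ hp K L).
have [eps eps0 epsP] := finite_quotient_gap vD cP.
have [|l [rho [rho1 rhoD rhoM rho0 rho_onto]]] := residue_field vM vD (c := c).
  by move=> x y xO yO /cP xy; apply/vposP; exists 1; rewrite ?xy.
have [s sP] := residue_action vM vD valuation_gal rho1 rhoD rhoM rho0 rho_onto.
split.
  move=> b; apply: (coef_integral vM vD (sigma := sigma) (@gal_rmorphism1 K L)
    (@gal_rmorphismM K L) (@gal_rmorphism_faithful K L) valuation_gal
    valuation_fixed rho1 rhoD rhoM rho0
    rho_onto sP eps0 epsP cardN transN).
have [m mO [m_int m_inj]] := integral_generator vM vD (sigma := sigma)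
  (@gal_rmorphism1 K L) (@gal_rmorphismM K L) (@gal_rmorphism_faithful K L)
  valuation_gal valuation_fixed rho1 rhoD
  rhoM rho0 rho_onto sP eps0 epsP cardN transN normN.
exists m => //; split=> // y yO.
exact: (integral_generator_onto (sigma := sigma) (@gal_rmorphism1 K L)
  (@gal_rmorphismM K L) valuation_gal
  cardN transN normN mO m_int m_inj yO).
Qed.

End UnramifiedOrder.

(** * The Hopf algebra L[N]^G and its action on L *)

Section HopfAlgebra.
Variables (K : fieldType) (L : splittingFieldType K).
Local Notation G := (gal_of {:L}).
Local Notation LP := (perm_algebra L G).
Local Notation sigma := (@gal_rmorphism K L).

Lemma galois_actE g (c : LP) :
  galois_act g c = semilinear_act sigma (@conj_lam G) g c.
Proof. by apply/ffunP => n; rewrite !ffunE conj_lamV. Qed.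

Lemma galois_actM g (a b : LP) :
  galois_act g (a * b) = galois_act g a * galois_act g b.
Proof.
apply/ffunP => k; rewrite !ffunE.
rewrite -[LHS]/(sigma g _) rmorph_sum.
rewrite [RHS](reindex_inj (@conjg_inj _ (lambda g))).
apply: eq_bigr => m _; rewrite rmorphM !ffunE conjgK; congr (sigma g (a _) * _).
by rewrite conjMg conjVg conjgK.
Qed.

Lemma galois_actB g (a b : LP) :
  galois_act g (a - b) = galois_act g a - galois_act g b.
Proof.
by apply/ffunP => n; rewrite !ffunE -![fun_of_lfun _ _]/(sigma g _) rmorphB.
Qed.

Lemma galois_act1 g : galois_act g (1 : LP) = 1.
Proof.
apply/ffunP => n; rewrite !ffunE -[LHS]/(sigma g _) rmorph_nat.
by rewrite conjg_eq1.
Qed.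

Variable N : {group {perm G}}.
Local Notation act := (hopf_act N).

Lemma hopf_actE (c : LP) x : act c x = perm_act N c (orbit_fun sigma x) 1%g.
Proof. by rewrite ffunE; apply: eq_bigr => n _; rewrite ffunE. Qed.

Lemma hopf_actDr (c : LP) x y : act c (x + y) = act c x + act c y.
Proof.
rewrite -big_split; apply: eq_bigr => n _.
by rewrite -[fun_of_lfun _ (x + y)]/(sigma _ _) rmorphD mulrDr.
Qed.

Lemma hopf_actDl (a b : LP) x : act (a + b) x = act a x + act b x.
Proof. by rewrite -big_split; apply: eq_bigr => n _; rewrite ffunE mulrDl. Qed.

Lemma hopf_actBl (a b : LP) x : act (a - b) x = act a x - act b x.
Proof. by rewrite -sumrB; apply: eq_bigr => n _; rewrite !ffunE mulrBl. Qed.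

Lemma hopf_act1 x : act 1 x = x.
Proof.
rewrite /hopf_act (bigD1 1%g) //= big1 ?addr0 => [|n /andP[_ /negPf n1]].
  by rewrite ffunE eqxx mul1r invg1 perm1 gal_id.
by rewrite ffunE n1 mul0r.
Qed.

Lemma hopf_algebra1 : hopf_algebra N 1.
Proof.
split=> [n nN|g]; last exact: galois_act1.
by rewrite ffunE; case: eqP nN => // ->; rewrite group1.
Qed.

Lemma hopf_algebraB (a b : LP) :
  hopf_algebra N a -> hopf_algebra N b -> hopf_algebra N (a - b).
Proof.
move=> [aN afix] [bN bfix]; split=> [n nN|g]; last by rewrite galois_actB afix bfix.
by rewrite !ffunE aN // bN // subr0.
Qed.

Lemma hopf_algebraM (a b : LP) :
  hopf_algebra N a -> hopf_algebra N b -> hopf_algebra N (a * b).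
Proof.
move=> [aN afix] [bN bfix]; split=> [k kN|g]; last by rewrite galois_actM afix bfix.
rewrite ffunE big1 // => m _; have [mN|/bN->] := boolP (m \in N); last exact: mulr0.
by rewrite aN ?mul0r // groupMl ?groupV.
Qed.

(** Since b is fixed by G, [bsigma] lets an automorphism y pass through the action of b, turning
    m^-1(1) into m^-1(y). The double sum is then regrouped along products in N. *)
Lemma hopf_actM (a b : LP) x :
    normalised_by_lambda N -> hopf_algebra N a -> hopf_algebra N b ->
  act (a * b) x = act a (act b x).
Proof.
move=> normN [aN _] [bN bfix].
have bsigma y : \sum_(m in N) b m * sigma (m^-1 y)%g x = sigma y (act b x).
  have bfix' g : semilinear_act sigma (@conj_lam G) g b = b.
    by rewrite -galois_actE.
  have /ffunP/(_ y) := perm_act_orbit_fun normN (@gal_rmorphismM K L) x bfix'.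
  rewrite -hopf_actE [RHS]ffunE ffunE => <-.
  by apply: eq_bigr => m _; rewrite ffunE.
transitivity (\sum_(m in N) \sum_(n in N)
    a n * (b m * sigma (m^-1 (n^-1 1))%g x)); last first.
  rewrite exchange_big; apply: eq_bigr => n _ /=.
  by rewrite -mulr_sumr bsigma.
transitivity (\sum_(k in N) \sum_(m in N)
    a (m^-1 * k)%g * (b m * (k^-1%g 1%g : G) x)).
  apply: eq_bigr => k _.
  rewrite ffunE mulr_suml [LHS](bigID (mem N)) /= addrC big1 ?add0r.
    by apply: eq_bigr => m _; rewrite mulrA.
  by move=> m /bN->; rewrite mulr0 mul0r.
rewrite exchange_big; apply: eq_bigr => m mN /=.
rewrite (reindex_inj (mulgI m)) /=.
apply: eq_big => [n|n _]; first by rewrite groupMl.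
by rewrite mulKg invMg permM.
Qed.
End HopfAlgebra.

Theorem theorem3p4 (p : nat) (hp : prime p)
    (K : fieldExtType (padic_rat hp)) (L : splittingFieldType K)
    (v : L -> rat) (N : {group {perm gal_of {:L}}}) :
  extends_padic_valuation v ->
  unramified v ->
  regular N ->
  normalised_by_lambda N ->
  associated_order N (valuation_ring v) =
    integral_fixed_points N (valuation_ring v) /\
  is_free_module (hopf_act N)
    (associated_order N (valuation_ring v)) (valuation_ring v).
Proof.
move=> v_ext v_unr regN normN.
have [coefO [m mO [m_inj m_onto]]] :=
  unramified_perm_module v_ext v_unr regN normN.
have [[vM vD] _] := v_ext.
have OE x : valuation_ring v x <-> vge v 0 x.
  rewrite /valuation_ring /vge /=; have [->|x0] /= := eqVneq x 0; first by split.
  by split=> [|? _ //]; apply.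
have sigmaO g x : vge v 0 x -> vge v 0 (gal_rmorphism g x).
  rewrite /vge fmorph_eq0; have [//|x0] := eqVneq x 0.
  by rewrite (valuation_gal v_ext).
have orderE : associated_order N (valuation_ring v) =
    integral_fixed_points N (valuation_ring v).
  apply/seteqP; split=> h [hN hO]; split=> //; last first.
    move=> x /OE xO; apply/OE/vge_sum => // n nN.
    apply: vgeM0 => //; first exact/OE.
    exact: (sigmaO (n^-1 1)%g).
  move=> n; apply/OE; have [nN|/(proj1 hN)->] := boolP (n \in N); last exact: vge0.
  by apply: (coefO h) => // x /OE/hO/OE.
split=> //; split.
- split.
  + by split=> [|x]; [exact: hopf_algebra1|rewrite hopf_act1].
  + move=> a b [aH aO] [bH bO]; split=> [|x xO]; first exact: hopf_algebraB.
    by rewrite hopf_actBl; apply/OE/(vgeB vM vD); apply/OE; [apply: aO|apply: bO].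
  + move=> a b [aH aO] [bH bO]; split=> [|x xO]; first exact: hopf_algebraM.
    by rewrite hopf_actM //; apply/aO/bO.
- split; [split|split].
  + by apply/OE/vge0.
  + by move=> x y /OE xO /OE yO; apply/OE/vgeB.
  + by move=> a x [_ aO]; apply: aO.
  + by move=> x _; apply: hopf_act1.
  + by move=> a b x [aH _] [bH _] _; apply: hopf_actM normN aH bH.
  + by move=> a x y _ _ _; apply: hopf_actDr.
  + by move=> a b x _ _ _; apply: hopf_actDl.
(* The integral generator alone is a basis. *)
exists [set m]%classic; split.
- by move=> x ->; apply/OE.
- move=> y /OE /m_onto[b [bN bfix bO bm]].
  exists [:: m], (fun=> b); split=> [x|x _|].
  + by rewrite inE => /eqP.
  + rewrite orderE; split; last by move=> n; apply/OE.
    by split=> // g; rewrite galois_actE.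
  + by rewrite big_seq1 hopf_actE bm.
move=> s c s_uniq sm cA c0 x xs.
have sE : s = [:: x].
  have xm := sm x xs; case: s s_uniq sm xs {cA c0} => // y [|z s].
    by rewrite inE => _ _ /eqP->.
  move=> + sm _; rewrite /= inE (sm y) ?mem_head // (sm z) ?eqxx //.
  by rewrite !inE eqxx orbT.
have xm : x = m := sm x xs; have [[xN xfix] _] := cA x xs.
move: c0; rewrite sE big_seq1 xm => c0.
rewrite xm in xN xfix *; apply: m_inj => //.
(* The relation is known at 1 only; fixedness of the coefficient spreads it over the whole orbit
   function. *)
rewrite (perm_act_orbit_fun normN (@gal_rmorphismM K L)) => [|g].
  by rewrite -hopf_actE c0; apply/ffunP => g; rewrite !ffunE rmorph0.
by rewrite -galois_actE.
Qed.
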